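(* Let $K \in \mathcal{K}^2$ with $\mathcal{E}_J(K) = \mathbb{B}^2$. Then $$D(K) \le D_{s_J(K)},$$ and any $x,y \in K$ satisfy $\|x-y\| = D_{s_J(K)}$ if and only if both of the following hold: (i) $\|x\| = \|y\| = \sqrt{\frac12 D_{s_J(K)}^2 - 2}$, and (ii) $\left\|\frac{x+y}{2}\right\| = \sqrt{\frac14 D_{s_J(K)}^2 - 2}$. Moreover, the inequality is best possible for any prescribed $s_J(K) \in [1,2]$; that is, for every $s \in [1,2]$ there exists $K \in \mathcal{K}^2$ with $\mathcal{E}_J(K) = \mathbb{B}^2$, $s_J(K) = s$ and $D(K) = D_s$.
   Context: $\mathcal{K}^2$ is the family of convex bodies in $\mathbb{R}^2$, i.e., compact convex sets with non-empty interior. $\mathbb{B}^2$ is the closed Euclidean unit disc, $\|\cdot\|$ the Euclidean norm, and $D(K)$ the Euclidean diameter of $K$. The John ellipsoid $\mathcal{E}_J(K)$ is the (unique) area-maximal ellipse contained in $K$; its center is denoted $c_J(K)$. The John asymmetry of $K$ is $s_J(K) = \inf\{\rho \ge 0 : K - c_J(K) \subset \rho\,(c_J(K) - K)\}$, which for planar bodies takes values in $[1,2]$. For $s \in [1,2]$, $$D_s = \sqrt{s^2 + 5 + \sqrt{4(2-s)^2 + (s^2-1)^2}}.$$ *)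

(* Defs.v *)
From HB Require Import structures.
From mathcomp Require Import all_boot all_order all_algebra.
From mathcomp Require Import all_classical all_reals all_analysis.

Set Implicit Arguments.
Unset Strict Implicit.
Unset Printing Implicit Defensive.

Import Order.TTheory GRing.Theory Num.Theory.
Import numFieldNormedType.Exports.

Local Open Scope classical_set_scope.
Local Open Scope ring_scope.

(* The canonical library norm on R * R is the sup norm: it induces the right
   topology (used for compactness and interior) but not the right distance. *)
Definition enorm (R : realType) (p : R * R) : R :=
  Num.sqrt (p.1 ^+ 2 + p.2 ^+ 2).

Definition unit_disc (R : realType) : set (R * R) := [set p | enorm p <= 1].

Definition convex_body (R : realType) (K : set (R * R)) : Prop :=
  [/\ compact K, convex_set K & interior K !=set0].

Definition diameter (R : realType) (K : set (R * R)) : R :=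
  sup [set r | exists x y, [/\ K x, K y & r = enorm (x - y)]].

Definition area (R : realType) (A : set (R * R)) : \bar R :=
  (@lebesgue_measure R \x @lebesgue_measure R)%E A.

Definition ellipse_at (R : realType) (c : R * R) (E : set (R * R)) : Prop :=
  exists f : {linear (R * R)%type -> (R * R)%type},
    bijective f /\ E = [set c + f u | u in @unit_disc R].

Definition ellipse (R : realType) (E : set (R * R)) : Prop :=
  exists c, ellipse_at c E.

Definition max_area_ellipse (R : realType) (K E : set (R * R)) : Prop :=
  [/\ ellipse E, E `<=` K &
      forall E' : set (R * R),
        ellipse E' -> E' `<=` K -> (area E' <= area E)%E].

(* For a convex body the area-maximal inscribed ellipse and its center exist
   and are unique, so the defaults of [xget] are irrelevant there; the default
   set0 is not an ellipse. *)
Definition john_ellipse (R : realType) (K : set (R * R)) : set (R * R) :=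
  xget set0 [set E | max_area_ellipse K E].

Definition john_center (R : realType) (K : set (R * R)) : R * R :=
  xget 0 [set c | ellipse_at c (john_ellipse K)].

Definition john_asymmetry (R : realType) (K : set (R * R)) : R :=
  let c := john_center K in
  inf [set rho : R | 0 <= rho /\
        [set x - c | x in K] `<=` [set rho *: (c - x) | x in K]].

Definition john_diam_bound (R : realType) (s : R) : R :=
  Num.sqrt (s ^+ 2 + 5 +
            Num.sqrt (4 * (2 - s) ^+ 2 + (s ^+ 2 - 1) ^+ 2)).

(* Main.v *)
Require Import Defs.
From HB Require Import structures.
From mathcomp Require Import all_boot all_order all_algebra.
From mathcomp Require Import all_classical all_reals all_analysis.
From mathcomp Require Import measurable_realfun.
From mathcomp Require Import ring lra.
Import Order.TTheory GRing.Theory Num.Theory.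
Import numFieldNormedType.Exports.
Local Open Scope classical_set_scope.
Local Open Scope ring_scope.

(** Why the theorem holds.

    Let the unit disc be the John ellipse of K, let s be the asymmetry and U
    the set of contact points, i.e. of unit vectors u with <z,u> <= 1 on K.
    Moving the disc to a nearby ellipse shows that a quadratic polynomial that
    is nonnegative on U has nonnegative mean with respect to a fictitious
    measure of mass 2, mean 0 and second moment the identity
    ([contact_john_set]); this is the dual form of John's theorem.  Since
    K is contained in -sK, every x in K satisfies -s <= <x,u> <= 1 on U
    ([body_slab]), and 1 <= s <= 2 ([asymmetry_bounds]).

    The diameter bound follows from these facts alone ([slab_diameter]).  For
    x, y in K put p = |x|^2, r = |y|^2, t = -<x,y> and assume r <= p.  The
    polynomials (1 - <x,u>)(s + <x,u>) and (1 - <x,u>)(1 - <y,u>) give p <= 2s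
    and t <= 2.  Each of x, y and -x/s cuts off an arc of the circle without
    contact points: <x,u> > 1, <y,u> > 1 and <x,u> < -s.  Suppose that
    |x - y| is at least the claimed bound.  If the arcs of y and of -x/s
    overlap and neither contains the other, their union is one long free arc,
    and the product of 1 - <x,u> with the affine function vanishing at the
    ends of a slightly shorter arc is nonnegative on U and has negative mean:
    a contradiction ([no_overlap]).  Otherwise the pair of values
    (<x,u>, <y,u>) = (-s, 1) is not strictly inside the ellipse traced by the
    circle, which is an inequality between p, r and t; together with
    |x - y|^2 = p + r + 2t it forces t = 2 and p = r, with equality in the
    bound ([no_overlap_tight]).  The two norms in the theorem are a
    reformulation of these equations by the parallelogram law.

    For sharpness, the extremal configuration determines four contact points,
    the vertices of an isosceles trapezoid U, and the body of all z with
    -s <= <z,u> <= 1 on U is extremal.  That its John ellipse is the disc is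
    the sufficiency half of John's theorem ([john_sufficiency]), where the
    polar decomposition of the competing ellipse reduces to a choice of one
    rotation or reflection. *)

Set Implicit Arguments.
Unset Strict Implicit.
Unset Printing Implicit Defensive.

(** * Plane vectors *)

Definition dot (R : realType) (p q : R * R) : R := p.1 * q.1 + p.2 * q.2.

Lemma dot_ge0 (R : realType) (p : R * R) : 0 <= dot p p.
Proof. by rewrite addr_ge0// -expr2 sqr_ge0. Qed.

Lemma dot_eq0 (R : realType) (p : R * R) : dot p p = 0 -> p = 0.
Proof.
case: p => x y; rewrite /dot /= -!expr2 => /eqP.
by rewrite paddr_eq0 ?sqr_ge0// !sqrf_eq0 => /andP[/eqP-> /eqP->].
Qed.

Lemma cauchy_schwarz (R : realType) (p q : R * R) : dot p q ^+ 2 <= dot p p * dot q q.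
Proof.
rewrite -subr_ge0; have -> : dot p p * dot q q - dot p q ^+ 2 =
  (p.1 * q.2 - p.2 * q.1) ^+ 2 by rewrite /dot; ring.
exact: sqr_ge0.
Qed.

Lemma unit_discE (R : realType) (z : R * R) : unit_disc z <-> dot z z <= 1.
Proof.
rewrite /unit_disc /= /enorm /dot -!expr2.
by rewrite -[X in _ <= X]sqrtr1 ler_sqrt.
Qed.

Lemma sqr_enorm (R : realType) (p : R * R) : enorm p ^+ 2 = dot p p.
Proof. by rewrite /enorm sqr_sqrtr -?/(dot p p) ?dot_ge0 /dot ?expr2//; exact: dot_ge0. Qed.

Lemma enormE (R : realType) (p : R * R) : enorm p = Num.sqrt (dot p p).
Proof. by rewrite /enorm /dot !expr2. Qed.

Lemma lt_of_sqr_lt (R : realType) (x y : R) : 0 <= y -> x ^+ 2 < y ^+ 2 -> x < y.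
Proof.
move=> y0 xy; case: (leP 0 x) => x0; last exact: lt_le_trans x0 y0.
by move: xy; rewrite ltr_pXn2r.
Qed.

(** * Area of ellipses *)

Lemma measurable_affine (R : realType) (a b : R) :
  measurable_fun [set: R] (fun y : R => a * y + b).
Proof.
apply: measurable_funD; last exact: measurable_cst.
by apply: measurable_funM; [exact: measurable_cst|exact: measurable_id].
Qed.

(** Both sides, cleared of the factor, are measures in [A] that agree on
    half-open intervals, and Lebesgue measure is determined by those values. *)
Lemma lebesgue_measure_affine (R : realType) (a b : R) (A : set R) : a != 0 ->
  measurable A ->
  @lebesgue_measure R ((fun y => a * y + b) @^-1` A) =
  ((`|a|^-1)%:E * @lebesgue_measure R A)%E.
Proof.
move=> a0 mA; have na0 : 0 < `|a| by rewrite normr_gt0.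
pose f : R -> measurableTypeR R := fun y : R => a * y + b.
have mf : measurable_fun [set: measurableTypeR R] f by exact: measurable_affine.
suff H B : measurable B -> @lebesgue_measure R B =
   (`|a|%:E * pushforward (@lebesgue_measure R) f B)%E.
  by rewrite (H A mA) muleA -EFinM mulVf ?mul1e// gt_eqF.
move=> mB; apply: (@lebesgue_measure_unique R
  (mscale (NngNum (ltW na0)) (pushforward (@lebesgue_measure R) f)) _ _ mB).
move=> _ [[u v]] _ <- /=; rewrite /mscale /= /pushforward /f /=.
have [/gtr0_norm naE|a1] := ltP 0 a; last first.
  have {}a1 : a < 0 by rewrite lt_neqAle a0.
  have naE := ltr0_norm a1; rewrite naE.
  rewrite (_ : _ @^-1` _ = `[a^-1 * (v - b), a^-1 * (u - b)[%classic); last first.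
    apply/seteqP; split => y /=; rewrite !in_itv /= => /andP[h1 h2].
      by rewrite -(ler_nM2l a1) -(ltr_nM2l a1) !mulrA mulfV// !mul1r; apply/andP; split; lra.
    move: h1 h2; rewrite -(ler_nM2l a1) -(ltr_nM2l a1) !mulrA mulfV// !mul1r => h1 h2.
    by apply/andP; split; lra.
  rewrite !lebesgue_measure_itv /= !lte_fin ltr_nM2l ?invr_lt0// ltrD2r.
  case: ifPn => _; last by rewrite mule0.
  by rewrite -!EFinD -EFinM; congr (_%:E); field.
rewrite naE.
have {}a1 : 0 < a by rewrite lt_neqAle eq_sym a0 -naE normr_ge0.
rewrite (_ : _ @^-1` _ = `]a^-1 * (u - b), a^-1 * (v - b)]%classic); last first.
  apply/seteqP; split => y /=; rewrite !in_itv /= => /andP[h1 h2].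
    by rewrite -(ler_pM2l a1) -(ltr_pM2l a1) !mulrA mulfV// !mul1r; apply/andP; split; lra.
  move: h1 h2; rewrite -(ler_pM2l a1) -(ltr_pM2l a1) !mulrA mulfV// !mul1r => h1 h2.
  by apply/andP; split; lra.
rewrite !lebesgue_measure_itv /= !lte_fin ltr_pM2l ?invr_gt0// ltrD2r.
case: ifPn => _; last by rewrite mule0.
by rewrite -!EFinD -EFinM; congr (_%:E); field.
Qed.

(** The map acts on each vertical section by a one-dimensional affine map of
    constant slope, so the claim is the previous one integrated over sections. *)
Lemma area_affine_snd (R : realType) (a k m : R) (A : set (R * R)) : a != 0 ->
  measurable A ->
  (@lebesgue_measure R \x @lebesgue_measure R)%E
    ((fun z : R * R => (z.1, a * z.2 + (k * z.1 + m))) @^-1` A) =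
  ((`|a|^-1)%:E * (@lebesgue_measure R \x @lebesgue_measure R) A)%E.
Proof.
move=> a0 mA; rewrite /product_measure1 -ge0_integralZl//; last exact: measurable_fun_xsection.
apply: eq_integral => x _ /=.
rewrite -(@lebesgue_measure_affine _ a (k * x + m))//.
exact: measurable_xsection.
Qed.

Lemma area_affine_fst (R : realType) (a k m : R) (A : set (R * R)) : a != 0 ->
  measurable A ->
  (@lebesgue_measure R \x @lebesgue_measure R)%E
    ((fun z : R * R => (a * z.1 + (k * z.2 + m), z.2)) @^-1` A) =
  ((`|a|^-1)%:E * (@lebesgue_measure R \x @lebesgue_measure R) A)%E.
Proof.
move=> a0 mA.
have mp : measurable_fun setT (fun z : R * R => (a * z.1 + (k * z.2 + m), z.2)).
  by apply: measurable_fun_pair => //; apply: measurable_funD;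
    [|apply: measurable_funD => //]; apply: measurable_funM.
(* The product measure can also be computed from horizontal sections. *)
have pmE : forall B : set (R * R), measurable B ->
    (@lebesgue_measure R \x @lebesgue_measure R)%E B =
    (@lebesgue_measure R \x^ @lebesgue_measure R)%E B.
  move=> B mB; apply: product_measure_unique => // *; exact: product_measure2E.
rewrite !pmE//; last by rewrite -[X in measurable X]setTI; exact: mp.
rewrite /product_measure2 -ge0_integralZl//; last exact: measurable_fun_ysection.
apply: eq_integral => y _ /=.
rewrite -(@lebesgue_measure_affine _ a (k * y + m))//.
exact: measurable_ysection.
Qed.

Lemma measurable_affine2 (R : realType) (a b c d m n : R) :
  measurable_fun setT
    (fun z : R * R => (a * z.1 + b * z.2 + m, c * z.1 + d * z.2 + n)).
Proof.
by apply: measurable_fun_pair; apply: measurable_funD => //;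
  apply: measurable_funD; apply: measurable_funM.
Qed.

(** If [a] is nonzero, the map is a change of the second coordinate after a
    change of the first; precomposing with a shear reduces to that case. *)
Lemma area_affine (R : realType) (a b c d m n : R) (A : set (R * R)) :
  a * d - b * c != 0 -> measurable A ->
  (@lebesgue_measure R \x @lebesgue_measure R)%E
    ((fun z : R * R => (a * z.1 + b * z.2 + m, c * z.1 + d * z.2 + n)) @^-1` A) =
  ((`|a * d - b * c|^-1)%:E * (@lebesgue_measure R \x @lebesgue_measure R) A)%E.
Proof.
move=> det0 mA.
wlog a0 : a b c d det0 / a != 0.
  move=> IH; have [a0|] := eqVneq a 0; last exact: IH.
  have b0 : b != 0.
    by apply: contraNneq det0 => ->; rewrite a0 mul0r mul0r subrr.
  pose B := (fun z : R * R => (a * z.1 + b * z.2 + m, c * z.1 + d * z.2 + n)) @^-1` A.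
  have mB : measurable B.
    by rewrite -[X in measurable X]setTI; exact: measurable_affine2.
  have := @area_affine_snd R 1 1 0 B (oner_neq0 _) mB.
  rewrite normr1 invr1 mul1e -/B => <-.
  have detE : a * d - b * c = (a + b) * d - b * (c + d) by ring.
  rewrite detE -(IH (a + b) b (c + d) d) -?detE//; last by rewrite a0 add0r.
  congr ((_ \x _)%E _); rewrite /B; apply/seteqP; split => z /=;
  (rewrite (_ : a * z.1 + b * (1 * z.2 + (1 * z.1 + 0)) + m = (a + b) * z.1 + b * z.2 + m); last ring);
  (rewrite (_ : c * z.1 + d * (1 * z.2 + (1 * z.1 + 0)) + n = (c + d) * z.1 + d * z.2 + n); last ring); by [].
pose e := d - b * c / a; pose k := c / a.
have e0 : e != 0.
  apply: contraNneq det0 => eE; have -> : a * d - b * c = a * e by rewrite /e; field.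
  by rewrite eE mulr0.
pose B := (fun z : R * R => (z.1, e * z.2 + (k * z.1 + (n - k * m)))) @^-1` A.
have mB : measurable B.
  rewrite -[X in measurable X]setTI.
  have := @measurable_affine2 R 1 0 k e 0 (n - k * m) measurableT A mA.
  congr (measurable _); congr (_ `&` _); rewrite /B.
  by apply/seteqP; split => z /=;
   (rewrite (_ : 1 * z.1 + 0 * z.2 + 0 = z.1); last ring);
   (rewrite (_ : k * z.1 + e * z.2 + _ = e * z.2 + (k * z.1 + (n - k * m))); last ring).
have -> : (fun z : R * R => (a * z.1 + b * z.2 + m, c * z.1 + d * z.2 + n)) @^-1` A =
  (fun z : R * R => (a * z.1 + (b * z.2 + m), z.2)) @^-1` B.
  rewrite /B; apply/seteqP; split => z /=;
  (rewrite (_ : a * z.1 + b * z.2 + m = a * z.1 + (b * z.2 + m)); last ring);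
  (rewrite (_ : e * z.2 + (k * (a * z.1 + (b * z.2 + m)) + (n - k * m)) =
     c * z.1 + d * z.2 + n); last by rewrite /e /k; field); by [].
rewrite area_affine_fst// area_affine_snd// muleA -EFinM; congr (_%:E * _)%E.
rewrite -invfM -normrM; congr (`|_|^-1).
by rewrite /e; field.
Qed.

Section linear_plane.
Variables (R : realType) (a b c d : R).

(** Linear maps in coordinates. The linear structure declared below makes them
    admissible as the linear part of an ellipse. *)
Definition planar_map (z : R * R) : R * R := (a * z.1 + b * z.2, c * z.1 + d * z.2).

Fact planar_map_is_linear : linear planar_map.
Proof.
by move=> k u v; rewrite /planar_map; congr pair; rewrite /= -?[k *: _]/(k * _); ring.
Qed.
HB.instance Definition _ := GRing.isLinear.Build R (R * R)%type (R * R)%type _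
  planar_map planar_map_is_linear.

Lemma planar_map_bij : a * d - b * c != 0 -> bijective planar_map.
Proof.
move=> D0; exists (fun z => ((d * z.1 - b * z.2) / (a * d - b * c),
    (a * z.2 - c * z.1) / (a * d - b * c))) => -[x y];
  by rewrite /planar_map /=; congr pair; field.
Qed.

End linear_plane.

Lemma linear_planar_mapE (R : realType) (f : {linear (R * R)%type -> (R * R)%type}) z :
  f z = planar_map (f (1, 0)).1 (f (0, 1)).1 (f (1, 0)).2 (f (0, 1)).2 z.
Proof.
have {1}-> : z = z.1 *: ((1, 0) : R * R) + z.2 *: ((0, 1) : R * R).
  by case: z => x y; congr pair; rewrite /= -?[_ *: _]/(_ * _); ring.
rewrite linearD !linearZ /planar_map /=.
by apply: injective_projections; rewrite /= -?[_ *: _]/(_ * _); ring.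
Qed.

(** If the determinant vanishes, both columns of the adjugate lie in the
    kernel; injectivity makes them zero, and then the whole matrix is zero. *)
Lemma bij_planar_map (R : realType) (a b c d : R) :
  bijective (planar_map a b c d) -> a * d - b * c != 0.
Proof.
move=> /bij_inj inj; apply/eqP => D0.
have /inj [] : planar_map a b c d (d, - c) = planar_map a b c d (0, 0).
  by rewrite /planar_map /=; congr pair; lra.
move=> d0 /eqP; rewrite oppr_eq0 => /eqP c0.
have /inj [] : planar_map a b c d (- b, a) = planar_map a b c d (0, 0).
  by rewrite /planar_map /=; congr pair; lra.
move=> /eqP; rewrite oppr_eq0 => /eqP b0 a0.
have /inj [] : planar_map a b c d (1, 0) = planar_map a b c d (0, 0).
  by rewrite /planar_map /= a0 b0 c0 d0; congr pair; lra.
by move/eqP; rewrite oner_eq0.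
Qed.

Lemma measurable_unit_disc (R : realType) : measurable (@unit_disc R).
Proof.
have -> : @unit_disc R = setT `&` (fun z : R * R => dot z z) @^-1` `]-oo, 1%R].
  by apply/seteqP; split => z; rewrite setTI /= in_itv /= => /unit_discE.
have : measurable_fun setT (fun z : R * R => dot z z).
  by apply: measurable_funD; apply: measurable_funM.
by apply => //; exact: measurable_itv.
Qed.

(** The ellipse is the preimage of the disc under the inverse affine map. *)
Lemma area_ellipse (R : realType) (p : R * R) (a b c d : R) : a * d - b * c != 0 ->
  area [set p + planar_map a b c d u | u in @unit_disc R] =
  (`|a * d - b * c|%:E * area (@unit_disc R))%E.
Proof.
move=> D0; set D := a * d - b * c.
pose a' := d / D; pose b' := - b / D; pose c' := - c / D; pose d' := a / D.
have D'E : a' * d' - b' * c' = D^-1.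
  by rewrite /a' /b' /c' /d' /D; field; rewrite D0.
have D'0 : a' * d' - b' * c' != 0 by rewrite D'E invr_neq0.
have := @area_affine R a' b' c' d' (- a' * p.1 - b' * p.2) (- c' * p.1 - d' * p.2) _ D'0
  (@measurable_unit_disc R).
rewrite D'E normfV invrK => <-; rewrite /area; congr ((_ \x _)%E _).
apply/seteqP; split => [_ [u uB <-]|z] /=.
  set w := (X in unit_disc X); suff -> : w = u by [].
  rewrite /w; case: (u) => x y; rewrite /planar_map /a' /b' /c' /d' /D /=; congr pair; field; exact: D0.
set w := (X in unit_disc X) => wB; exists w => //.
rewrite /w; case: (z) => x y; apply: injective_projections;
 rewrite /planar_map /a' /b' /c' /d' /D /=; field; exact: D0.
Qed.

(** Finiteness and positivity are needed to cancel this area; they come from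
    an inscribed and a circumscribed square. *)
Lemma area_unit_disc (R : realType) :
  (0 < area (@unit_disc R))%E /\ (area (@unit_disc R) < +oo)%E.
Proof.
have mX (h : R) : measurable (`[-h, h]%classic `*` `[-h, h]%classic : set (R * R)).
  by apply: measurableX; exact: measurable_itv.
have aX (h : R) : 0 < h -> area (`[-h, h]%classic `*` `[-h, h]%classic : set (R * R)) = ((2 * h) ^+ 2)%:E.
  move=> h0; rewrite /area product_measure1E//.
  rewrite -[LHS]/(@lebesgue_measure R _ * @lebesgue_measure R _)%E !lebesgue_measure_itv /= !lte_fin.
  rewrite ifT; last by lra.
  by rewrite -!EFinD -EFinM; congr (_%:E); ring.
split.
  apply: (@lt_le_trans _ _ (area (`[-(2^-1), 2^-1]%classic `*` `[-(2^-1), 2^-1]%classic : set (R * R)))).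
    by rewrite aX ?lte_fin ?exprn_gt0// ?invr_gt0//; lra.
  rewrite /area; apply: le_measure; [|apply: mem_set; exact: measurable_unit_disc|].
    by apply: mem_set; exact: (mX 2^-1).
  move=> z [] /=; rewrite !in_itv /= => /andP[h1 h2] /andP[h3 h4].
  by apply/unit_discE; rewrite /dot; nra.
apply: (@le_lt_trans _ _ (area (`[-1, 1]%classic `*` `[-1, 1]%classic : set (R * R)))).
  rewrite /area; apply: le_measure; [apply: mem_set; exact: measurable_unit_disc| |].
    by apply: mem_set; exact: (mX 1).
  move=> z /unit_discE; rewrite /dot => h; split; rewrite /= in_itv /=; apply/andP; split; nra.
by rewrite aX ?ltry//.
Qed.

(** * Separation of a point from a convex body *)

Lemma continuous_affine (R : realType) (a b c : R) :
  continuous (fun z : R * R => a * z.1 + b * z.2 + c : R).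
Proof.
move=> z; apply: cvgD; last exact: cvg_cst.
by apply: cvgD; apply: cvgM; [exact: cvg_cst|exact: cvg_fst|exact: cvg_cst|exact: cvg_snd].
Qed.

Lemma continuous_quadratic (R : realType) (a b m11 m12 m22 c : R) :
  continuous (fun z : R * R => a * z.1 + b * z.2 + m11 * z.1 ^+ 2 +
     m12 * (z.1 * z.2) + m22 * z.2 ^+ 2 + c : R).
Proof.
move=> z; apply: cvgD; last exact: cvg_cst.
apply: cvgD; last by apply: cvgM; [exact: cvg_cst|apply: cvgM; exact: cvg_snd].
apply: cvgD; last by apply: cvgM; [exact: cvg_cst|apply: cvgM; [exact: cvg_fst|exact: cvg_snd]].
apply: cvgD; last by apply: cvgM; [exact: cvg_cst|apply: cvgM; exact: cvg_fst].
by apply: cvgD; apply: cvgM; [exact: cvg_cst|exact: cvg_fst|exact: cvg_cst|exact: cvg_snd].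
Qed.

Lemma convex_comb (R : realType) (K : set (R * R)) (x y : R * R) (l : R) :
  convex_set K -> K x -> K y -> 0 <= l -> l <= 1 ->
  K (l * x.1 + (1 - l) * y.1, l * x.2 + (1 - l) * y.2).
Proof.
move=> cK Kx Ky l0 l1.
have l01 : Itv.spec (@Itv.num_sem R) (Itv.Real `[0%Z, 1%Z]) l.
  by rewrite /Itv.spec /= /Itv.num_sem /= num_real /= in_itv /= l0.
by have := cK x y (Itv.mk l01) (mem_set Kx) (mem_set Ky) => /set_mem.
Qed.

(** The separating direction points from the nearest point [c] of [K] to [z];
    if some [k] in [K] were beyond the line through [c] orthogonal to it, a
    short step from [c] towards [k] would come closer to [z]. *)
Lemma separation (R : realType) (K : set (R * R)) (z : R * R) :
  compact K -> convex_set K -> K !=set0 -> ~ K z ->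
  exists v, dot v v = 1 /\ forall k, K k -> dot k v < dot z v.
Proof.
move=> cK vK K0 Kz.
pose f (k : R * R) : R := - 2 * z.1 * k.1 + - 2 * z.2 * k.2 + 1 * k.1 ^+ 2 +
   0 * (k.1 * k.2) + 1 * k.2 ^+ 2 + dot z z.
have fE k : f k = dot (k.1 - z.1, k.2 - z.2) (k.1 - z.1, k.2 - z.2).
  by rewrite /f /dot /=; ring.
have [|c /set_mem Kc cmin] := @compact_EVT_min _ _ f K K0 cK.
  by apply: continuous_subspaceT; exact: continuous_quadratic.
pose w : R * R := (z.1 - c.1, z.2 - c.2).
have ww0 : 0 < dot w w.
  rewrite lt_neqAle dot_ge0 andbT; apply/eqP => /esym/dot_eq0 [w1 w2].
  by apply: Kz; rewrite (_ : z = c)//; apply: injective_projections; lra.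
have kw k : K k -> dot k w <= dot c w.
  move=> Kk; rewrite leNgt; apply/negP => h.
  pose al := dot k w - dot c w; pose q := dot (k.1 - c.1, k.2 - c.2) (k.1 - c.1, k.2 - c.2).
  have al0 : 0 < al by rewrite subr_gt0.
  have q0 : 0 <= q by exact: dot_ge0.
  (* A step of relative length [l] beats the distance, as [l q < 2 al]. *)
  pose l := al / (q + al).
  have lE : l * (q + al) = al by rewrite /l divfK// gt_eqF//; lra.
  have l0 : 0 < l by rewrite /l divr_gt0//; lra.
  have l1 : l <= 1 by rewrite /l ler_pdivrMr; lra.
  have := cmin _ (mem_set (convex_comb vK Kk Kc (ltW l0) l1)).
  rewrite !fE -subr_ge0.
  set x := (X in 0 <= X).
  have -> : x = l * (l * q - 2 * al) by rewrite /x /al /q /w /dot /=; ring.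
  rewrite pmulr_rge0//; move: lE; rewrite mulrDr.
  have : 0 < l * al by rewrite mulr_gt0.
  lra.
have s0 : 0 < Num.sqrt (dot w w) by rewrite sqrtr_gt0.
exists (w.1 / Num.sqrt (dot w w), w.2 / Num.sqrt (dot w w)); split.
  have : Num.sqrt (dot w w) ^+ 2 = dot w w by rewrite sqr_sqrtr// ltW.
  move: s0; set S := Num.sqrt _ => S0 SE.
  apply: (@mulIf _ (S ^+ 2)); first by rewrite gt_eqF// exprn_gt0.
  rewrite mul1r {2}SE /dot /=; field; by rewrite gt_eqF.
move=> k /kw kle.
have dE p : dot p (w.1 / Num.sqrt (dot w w), w.2 / Num.sqrt (dot w w)) =
   dot p w / Num.sqrt (dot w w) by rewrite /dot /=; ring.
rewrite !dE ltr_pM2r ?invr_gt0//; apply: (le_lt_trans kle).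
by rewrite -subr_gt0; move: ww0; rewrite /w /dot /=; lra.
Qed.

Lemma compact_circle (R : realType) : compact [set u : R * R | dot u u = 1].
Proof.
have cS : compact (`[(-1 : R), 1]%classic `*` `[(-1 : R), 1]%classic).
  by apply: compact_setX; exact: segment_compact.
apply: (subclosed_compact _ cS).
- rewrite (_ : mkset _ = (fun u : R * R => 0 * u.1 + 0 * u.2 + 1 * u.1 ^+ 2 +
   0 * (u.1 * u.2) + 1 * u.2 ^+ 2 + 0) @^-1` [set 1]).
    apply: closed_comp; last exact: closed_eq.
    by move=> z _; exact: continuous_quadratic.
  by apply/seteqP; split => u /=; rewrite /dot => H; rewrite -[RHS]H; ring.
- move=> u /=; rewrite /dot => h; rewrite /= !in_itv /=.
  by split; apply/andP; split; nra.
Qed.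

(** * First variation of the inscribed disc *)

(** The dual form of John's decomposition of the identity: [U] satisfies it as
    soon as some measure on [U] of mass 2 has mean 0 and second moment matrix
    the identity, since the conclusion is then the integral of the quadratic. *)
Definition john_set (R : realType) (U : set (R * R)) :=
  forall (a : R) (b : R * R) (m11 m12 m22 : R),
    (forall u, U u -> 0 <= a + dot b u + m11 * u.1 ^+ 2 + m12 * (u.1 * u.2) + m22 * u.2 ^+ 2) ->
    0 <= 2 * a + m11 + m22.

(** All certificates in the diameter estimate are products of two affine
    functions, one for each of two arcs free of contact points. *)
Lemma john_set_prod (R : realType) (U : set (R * R)) al be (v w : R * R) :
  john_set U -> (forall u, U u -> 0 <= (al + dot v u) * (be + dot w u)) ->
  0 <= 2 * al * be + dot v w.
Proof.
move=> JU pos.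
have E : 2 * (al * be) + v.1 * w.1 + v.2 * w.2 = 2 * al * be + dot v w by rewrite /dot; ring.
rewrite -E; apply: (JU _ (al * w.1 + be * v.1, al * w.2 + be * v.2) _
  (v.1 * w.2 + v.2 * w.1)) => u /pos.
rewrite /dot /=; set x := (X in 0 <= X -> _).
by set y := (X in _ -> 0 <= X); have -> : x = y by rewrite /x /y; ring.
Qed.

(** If [K] contains the unit disc, these are the boundary points common to [K]
    and the disc, since the tangent of the disc at such a point supports [K]. *)
Definition contact (R : realType) (K : set (R * R)) : set (R * R) :=
  [set u | dot u u = 1 /\ forall z, K z -> dot z u <= 1].

Lemma unit_abs_le1 (R : realType) (u : R * R) : dot u u <= 1 ->
  `|u.1| <= 1 /\ `|u.2| <= 1.
Proof. by rewrite /dot !ler_norml => h; split; apply/andP; split; nra. Qed.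

Lemma le_abs_mul (R : realType) (a x y : R) : `|x| <= 1 -> `|y| <= 1 -> a * x * y <= `|a|.
Proof.
move=> x1 y1; apply: le_trans (ler_norm _) _; rewrite !normrM -mulrA ler_piMr//.
by rewrite mulr_ile1.
Qed.

Section perturbation.
Variables (R : realType) (b : R * R) (m11 m12 m22 : R).

(** As [w] runs over the disc, this is the ellipse with center [e b] and matrix
    [I + e M], where [M] is symmetric with entries [m11], [m12], [m22]. *)
Definition perturb (e : R) (w : R * R) : R * R :=
  (e * b.1 + ((1 + e * m11) * w.1 + e * m12 * w.2),
   e * b.2 + (e * m12 * w.1 + (1 + e * m22) * w.2)).

(** The derivative at [e = 0] of the support function of the perturbed disc in
    the direction of a unit vector [u]. *)
Definition perturb_form (u : R * R) : R :=
  b.1 * u.1 + b.2 * u.2 + m11 * u.1 ^+ 2 + (2 * m12) * (u.1 * u.2) + m22 * u.2 ^+ 2.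

Definition perturb_bound : R := `|b.1| + `|b.2| + `|m11| + 2 * `|m12| + `|m22|.

Lemma perturb_bound_ge0 : 0 <= perturb_bound.
Proof. by rewrite !addr_ge0 ?normr_ge0// mulr_ge0. Qed.

Lemma dot_perturb_le (e : R) u w : 0 <= e -> dot u u = 1 -> dot w w <= 1 ->
  dot (perturb e w) u <= 1 + e * perturb_bound.
Proof.
move=> e0 u1 w1.
have [h1 h2] : `|u.1| <= 1 /\ `|u.2| <= 1 by apply: unit_abs_le1; rewrite u1.
have [h3 h4] := unit_abs_le1 w1.
have wu : dot w u <= 1.
  apply: le_trans (ler_norm _) _; rewrite -(@expr_le1 _ 2)// real_normK ?num_real//.
  by apply: le_trans (cauchy_schwarz _ _) _; rewrite u1 mulr1.
have n1 : `|1 : R| <= 1 by rewrite normr1.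
have -> : dot (perturb e w) u = dot w u + e * (b.1 * u.1 * 1 + b.2 * u.2 * 1 + m11 * w.1 * u.1
    + m12 * w.2 * u.1 + m12 * w.1 * u.2 + m22 * w.2 * u.2) by rewrite /dot /perturb /=; ring.
apply: lerD => //; apply: ler_wpM2l => //; rewrite /perturb_bound.
have := le_abs_mul b.1 h1 n1; have := le_abs_mul b.2 h2 n1.
have := le_abs_mul m11 h3 h1; have := le_abs_mul m12 h4 h1.
have := le_abs_mul m12 h3 h2; have := le_abs_mul m22 h4 h2.
lra.
Qed.

(** The support function of the perturbed disc at [u] is the norm of
    [(I + e M) u] plus [e <b,u>]; after squaring, its excess over 1 is
    [2 e] times the form up to a term of order [e^2]. *)
Lemma dot_perturb_le1 (e m : R) u w : 0 < e -> 0 < m -> dot u u = 1 -> dot w w <= 1 ->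
  perturb_form u <= - m -> e * (1 + perturb_bound) ^+ 2 <= m -> e * perturb_bound <= 1 ->
  dot (perturb e w) u <= 1.
Proof.
move=> e0 m0 u1 w1 G em e1; have C0 := perturb_bound_ge0.
have [h1 h2] : `|u.1| <= 1 /\ `|u.2| <= 1 by apply: unit_abs_le1; rewrite u1.
pose q : R * R := ((1 + e * m11) * u.1 + e * m12 * u.2,
                   e * m12 * u.1 + (1 + e * m22) * u.2).
pose beta := b.1 * u.1 + b.2 * u.2.
have -> : dot (perturb e w) u = e * beta + dot w q by rewrite /dot /perturb /q /beta /=; ring.
have n1 : `|1 : R| <= 1 by rewrite normr1.
have bC : beta <= perturb_bound.
  have := le_abs_mul b.1 h1 n1; have := le_abs_mul b.2 h2 n1; rewrite /beta /perturb_bound.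
  have := normr_ge0 m11; have := normr_ge0 m12; have := normr_ge0 m22; lra.
have eb1 : e * beta <= 1 by apply: le_trans e1; rewrite ler_pM2l.
suff : dot w q <= 1 - e * beta by lra.
rewrite leNgt; apply/negP => h.
have h' : (1 - e * beta) ^+ 2 < dot w q ^+ 2.
  by rewrite ltr_pXn2r// nnegrE; lra.
have qq : dot w q ^+ 2 <= dot q q.
  by apply: le_trans (cauchy_schwarz _ _) _; rewrite ler_piMl// dot_ge0.
pose r1 := m11 * u.1 + m12 * u.2; pose r2 := m12 * u.1 + m22 * u.2.
have r1C : r1 ^+ 2 <= perturb_bound ^+ 2.
  rewrite -[r1 ^+ 2]real_normK ?num_real// ler_pXn2r ?nnegrE ?normr_ge0//.
  have := le_abs_mul m11 h1 n1; have := le_abs_mul m12 h2 n1.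
  have := le_abs_mul (- m11) h1 n1; have := le_abs_mul (- m12) h2 n1.
  have := normr_ge0 b.1; have := normr_ge0 b.2; have := normr_ge0 m12; have := normr_ge0 m22.
  by rewrite !normrN /r1 /perturb_bound ler_norml => *; apply/andP; split; lra.
have r2C : r2 ^+ 2 <= perturb_bound ^+ 2.
  rewrite -[r2 ^+ 2]real_normK ?num_real// ler_pXn2r ?nnegrE ?normr_ge0//.
  have := le_abs_mul m12 h1 n1; have := le_abs_mul m22 h2 n1.
  have := le_abs_mul (- m12) h1 n1; have := le_abs_mul (- m22) h2 n1.
  have := normr_ge0 b.1; have := normr_ge0 b.2; have := normr_ge0 m12; have := normr_ge0 m11.
  by rewrite !normrN /r2 /perturb_bound ler_norml => *; apply/andP; split; lra.
have E : dot q q - (1 - e * beta) ^+ 2 = dot u u - 1 +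
   e * (2 * perturb_form u + e * (r1 ^+ 2 + r2 ^+ 2 - beta ^+ 2)).
  by rewrite /dot /q /perturb_form /r1 /r2 /beta /=; ring.
have : e * (r1 ^+ 2 + r2 ^+ 2 - beta ^+ 2) <= 2 * m.
  have : e * (r1 ^+ 2 + r2 ^+ 2 - beta ^+ 2) <= e * (2 * (1 + perturb_bound) ^+ 2).
    by rewrite ler_pM2l//; have := sqr_ge0 beta; lra.
  lra.
move=> h5; have : 0 < dot q q - (1 - e * beta) ^+ 2 by lra.
by rewrite E u1 subrr add0r pmulr_rgt0//; lra.
Qed.

(** In a direction that is not a contact point, [K] has width to spare, and in
    a contact direction the support function of the perturbed disc decreases at
    first order; compactness of the circle makes both uniform in [e], and
    separation turns inequalities between support functions into inclusion. *)
Lemma perturbed_disc_subset (K : set (R * R)) : convex_body K ->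
  @unit_disc R `<=` K ->
  (forall u, contact K u -> perturb_form u < 0) ->
  \forall e \near 0^'+, forall w, @unit_disc R w -> K (perturb e w).
Proof.
move=> [cK vK _] BK neg.
have C0 := perturb_bound_ge0.
have K0 : K !=set0 by exists 0; apply: BK; apply/unit_discE; rewrite /dot /= mulr0 addr0.
(* For all small [e], in every direction some point of [K] lies at least as far
   as the perturbed disc. *)
have cov : \forall e \near 0^'+, [set u : R * R | dot u u = 1] `<=`
   [set u | forall w, dot w w <= 1 -> exists2 z, K z & dot (perturb e w) u <= dot z u].
  have /compact_near_coveringP/near_covering_withinP := @compact_circle R.
  apply => u /= u1.
  have e_gt0 : \forall e \near 0^'+, (0 : R) < e by exact: nbhs_right_gt.
  have [[z Kz zu]|nz] := pselect (exists2 z, K z & 1 < dot z u).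
    pose m := (dot z u - 1) / 2; have m0 : 0 < m by rewrite /m; lra.
    have A : \forall v \near u, 1 + m < dot z v.
      have cz : z.1 * v.1 + z.2 * v.2 + 0 @[v --> u] --> z.1 * u.1 + z.2 * u.2 + 0.
        exact: continuous_affine.
      have hm : 1 + m < z.1 * u.1 + z.2 * u.2 + 0 by move: zu; rewrite /m /dot; lra.
      by apply: filterS (cvgr_gt _ cz _ hm) => v; rewrite addr0.
    have thr0 : 0 < m / (perturb_bound + 1) by rewrite divr_gt0//; lra.
    have B := nbhs_right_lt thr0.
    exists ([set v | 1 + m < dot z v], [set e | 0 < e /\ e < m / (perturb_bound + 1)]).
      by split => //=; apply: filterI.
    move=> [v e] /= [h1 [h2 h3]] v1 w w1; exists z => //; apply: ltW; apply: le_lt_trans h1.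
    apply: le_trans (dot_perturb_le (ltW h2) v1 w1) _; rewrite lerD2l.
    move: h3; rewrite ltr_pdivlMr; last lra.
    by lra.
  have uc : contact K u.
    split => // z Kz; rewrite leNgt; apply/negP => h; apply: nz; by exists z.
  have Gu := neg _ uc.
  pose m := - perturb_form u / 2; have m0 : 0 < m by rewrite /m; lra.
  have A : \forall v \near u, perturb_form v < - m.
    have cz : perturb_form v + 0 @[v --> u] --> perturb_form u + 0.
      exact: continuous_quadratic.
    have hm : perturb_form u + 0 < - m by rewrite /m; lra.
    by apply: filterS (cvgr_lt _ cz _ hm) => v; rewrite addr0.
  have t1 : 0 < m / (1 + perturb_bound) ^+ 2 by rewrite divr_gt0// exprn_gt0//; lra.
  have t2 : 0 < (1 + perturb_bound)^-1 by rewrite invr_gt0; lra.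
  exists ([set v | perturb_form v < - m],
    [set e | 0 < e /\ (e < m / (1 + perturb_bound) ^+ 2 /\ e < (1 + perturb_bound)^-1)]).
    split => //=; apply: filterI => //; apply: filterI; exact: nbhs_right_lt.
  move=> [v e] /= [h1 [h2 [h3 h4]]] v1 w w1; exists v.
    by apply: BK; apply/unit_discE; rewrite v1.
  rewrite v1; apply: (dot_perturb_le1 h2 m0) => //; first exact: ltW.
    by rewrite -ler_pdivlMr ?exprn_gt0//; [exact: ltW|lra].
  move: h4; rewrite -[X in _ < X]mul1r ltr_pdivlMr; last lra.
  by lra.
apply: filterS cov => e cov w /unit_discE w1; apply: contrapT => nK.
have [v [v1 sep]] := separation cK vK K0 nK.
have [z Kz] := cov v v1 w w1.
by rewrite leNgt sep.
Qed.

(** Otherwise the perturbed disc stays in [K] for small [e], while its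
    determinant [1 + e tr M + O(e^2)] exceeds 1. *)
Lemma max_area_contact (K : set (R * R)) : convex_body K ->
  max_area_ellipse K (@unit_disc R) -> 0 < m11 + m22 ->
  exists2 u, contact K u & 0 <= perturb_form u.
Proof.
move=> bK [_ BK maxB] tr; apply: contrapT => no.
have neg u : contact K u -> perturb_form u < 0.
  by move=> cu; rewrite ltNge; apply/negP => h; apply: no; exists u.
have near_sub := perturbed_disc_subset bK BK neg.
pose dt := `|m11 * m22 - m12 ^+ 2| + 1.
have dt0 : 0 < dt by rewrite /dt; have := normr_ge0 (m11 * m22 - m12 ^+ 2); lra.
have t0 : 0 < (m11 + m22) / dt by rewrite divr_gt0.
have near_thr := nbhs_right_lt t0.
have near_pos := @nbhs_right_gt R 0.
have near_all : \forall e \near 0^'+, ((forall w, @unit_disc R w -> K (perturb e w)) /\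
    e < (m11 + m22) / dt) /\ 0 < e.
  by apply: filterI near_pos; apply: filterI near_sub near_thr.
have [e PP] : exists e, ((forall w, @unit_disc R w -> K (perturb e w)) /\
    e < (m11 + m22) / dt) /\ 0 < e by exact: (@filter_ex _ _ (at_right_proper_filter (0 : R)) _ near_all).
case: PP => PP e0. case: PP => sub lt0.
have detE : (1 + e * m11) * (1 + e * m22) - (e * m12) * (e * m12) =
   1 + e * (m11 + m22 + e * (m11 * m22 - m12 ^+ 2)) by ring.
have det1 : 1 < (1 + e * m11) * (1 + e * m22) - (e * m12) * (e * m12).
  rewrite detE ltrDl pmulr_rgt0//.
  move: lt0; rewrite ltr_pdivlMr// /dt mulrDr mulr1.
  have : - (e * (m11 * m22 - m12 ^+ 2)) <= e * `|m11 * m22 - m12 ^+ 2|.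
    by rewrite -mulrN ler_pM2l// -normrN ler_norm.
  lra.
have det0 : (1 + e * m11) * (1 + e * m22) - (e * m12) * (e * m12) != 0.
  by rewrite gt_eqF//; lra.
have perturbE w : perturb e w = (e * b.1, e * b.2) +
   planar_map (1 + e * m11) (e * m12) (e * m12) (1 + e * m22) w by [].
pose E' := [set (e * b.1, e * b.2) +
   planar_map (1 + e * m11) (e * m12) (e * m12) (1 + e * m22) u | u in @unit_disc R].
have : (area E' <= area (@unit_disc R))%E.
  apply: maxB.
    exists (e * b.1, e * b.2).
    exists (planar_map (1 + e * m11) (e * m12) (e * m12) (1 + e * m22)); split => //.
    exact: planar_map_bij.
  by move=> _ [w wB <-]; rewrite -perturbE; exact: sub.
rewrite area_ellipse// gtr0_norm; last by lra.
have [a0 aoo] := area_unit_disc R.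
have afin : area (@unit_disc R) \is a fin_num by rewrite ge0_fin_numE// ltW.
rewrite -(fineK afin) -EFinM lee_fin leNgt; apply/negP; rewrite negbK.
by rewrite -[X in X < _]mul1r ltr_pM2r// -lte_fin fineK.
Qed.

End perturbation.

Theorem contact_john_set (R : realType) (K : set (R * R)) : convex_body K ->
  max_area_ellipse K (@unit_disc R) -> john_set (contact K).
Proof.
move=> bK mK a b m11 m12 m22 pos; rewrite leNgt; apply/negP => neg.
(* Spreading the deficit over the circle makes the trace positive and keeps
   the form negative on the contact points. *)
pose k := - (2 * a + m11 + m22) / 4.
have k0 : 0 < k by rewrite /k; lra.
have [|u [u1 cu]] := @max_area_contact R (- b.1, - b.2)
   (- m11 - a - k) (- m12 / 2) (- m22 - a - k) K bK mK.
  by rewrite /k; lra.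
set G := perturb_form _ _ _ _ _.
have -> : G = - (a + dot b u + m11 * u.1 ^+ 2 + m12 * (u.1 * u.2) + m22 * u.2 ^+ 2) - k
   + (1 - dot u u) * (a + k).
  by rewrite /G /perturb_form /dot /=; field.
rewrite u1 subrr mul0r addr0 => h.
by have := pos u (conj u1 cu); lra.
Qed.

(** * A criterion for the disc to be the John ellipse *)

Section sufficiency.
Variables (R : realType) (U : set (R * R)).
Hypotheses (Uunit : forall u, U u -> dot u u = 1) (qU : john_set U).

(** With [w = Q^T u] for an orthogonal [Q], the hypothesis bounds a quadratic
    in [u] whose trace part is [tr (F Q^T)], [F] being the matrix of the
    ellipse, so [tr (F Q^T) <= 2].  The best [Q] with the sign of the determinant
    gives [rho], and [rho^2] is [4 |det F|] plus two squares.  In the equality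
    case these squares vanish, so [F] is orthogonal, and the center vanishes
    because it has nonpositive product with all of [U], whose mean is 0. *)
Lemma ellipse_in_polar (p : R * R) (a b g d : R) :
  a * d - b * g != 0 ->
  (forall w u, unit_disc w -> U u -> dot (p + planar_map a b g d w) u <= 1) ->
  `|a * d - b * g| <= 1 /\
  (1 <= `|a * d - b * g| ->
    [set p + planar_map a b g d w | w in @unit_disc R] = @unit_disc R).
Proof.
move=> D0 sub; set det := a * d - b * g in D0 *.
pose ep : R := Num.sg det.
have ep2 : ep ^+ 2 = 1 by rewrite /ep sqr_sg D0.
have epd : ep * det = `|det| by rewrite /ep normrEsg.
pose A := a + ep * d; pose B := g - ep * b.
have AB : A ^+ 2 + B ^+ 2 = (a - ep * d) ^+ 2 + (g + ep * b) ^+ 2 + 4 * `|det|.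
  by rewrite -epd /A /B /det; ring.
have det_gt0 : 0 < `|det| by rewrite normr_gt0.
have s1 := sqr_ge0 (a - ep * d); have s2 := sqr_ge0 (g + ep * b).
pose rho := Num.sqrt (A ^+ 2 + B ^+ 2).
have rho2 : rho ^+ 2 = A ^+ 2 + B ^+ 2 by rewrite sqr_sqrtr//; lra.
have rho0 : 0 < rho by rewrite sqrtr_gt0; lra.
have rhole : rho <= 2.
  (* [Q^T] has rows [(k, l)] and [ep (-l, k)]. *)
  pose k := A / rho; pose l := B / rho.
  have kl : k ^+ 2 + l ^+ 2 = 1.
    rewrite /k /l !expr_div_n -mulrDl -rho2 divff//.
    by rewrite gt_eqF// exprn_gt0.
  have tr : k * A + l * B = rho.
    apply: (@mulIf _ rho); first by rewrite gt_eqF.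
    by rewrite -expr2 rho2 /k /l; field; rewrite gt_eqF.
  have : 0 <= 2 * 1 + - (a * k - ep * (b * l)) + - (g * l + ep * (d * k)).
    apply: (qU (b := (- p.1, - p.2)) (m12 := - (a * l + ep * (b * k) + g * k - ep * (d * l)))).
    move=> u uU; have u1 := Uunit uU.
    pose w : R * R := (k * u.1 + l * u.2, ep * (- l * u.1 + k * u.2)).
    have wB : unit_disc w.
      apply/unit_discE; rewrite (_ : dot w w = 1)//.
      have -> : dot w w = (k * u.1 + l * u.2) ^+ 2 + ep ^+ 2 * (- l * u.1 + k * u.2) ^+ 2.
        by rewrite /dot /w /=; ring.
      rewrite ep2; transitivity ((k ^+ 2 + l ^+ 2) * dot u u); first by rewrite /dot; ring.
      by rewrite kl u1 mulr1.
    have := sub w u wB uU.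
    have -> : dot (p + planar_map a b g d w) u = dot p u + (a * k - ep * (b * l)) * u.1 ^+ 2
      + (a * l + ep * (b * k) + g * k - ep * (d * l)) * (u.1 * u.2)
      + (g * l + ep * (d * k)) * u.2 ^+ 2.
      by rewrite /dot /planar_map /w /=; ring.
    by rewrite /dot /=; lra.
  have : k * A + l * B = (a * k - ep * (b * l)) + (g * l + ep * (d * k)) by rewrite /A /B; ring.
  by rewrite tr; lra.
have rho4 : rho ^+ 2 <= 4 by nra.
split; first lra.
move=> det1.
have /eqP : (a - ep * d) ^+ 2 = 0 by lra.
rewrite sqrf_eq0 subr_eq0 => /eqP aE.
have /eqP : (g + ep * b) ^+ 2 = 0 by lra.
rewrite sqrf_eq0 addr_eq0 => /eqP gE.
have dE : d = ep * a by rewrite aE mulrA -expr2 ep2 mul1r.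
have detE : a ^+ 2 + b ^+ 2 = 1.
  have : ep * det = ep ^+ 2 * (a ^+ 2 + b ^+ 2) by rewrite /det gE dE; ring.
  by rewrite epd ep2; lra.
have isom w : dot (planar_map a b g d w) (planar_map a b g d w) = dot w w.
  transitivity ((a * w.1 + b * w.2) ^+ 2 + ep ^+ 2 * (- b * w.1 + a * w.2) ^+ 2).
    by rewrite /dot /planar_map gE dE /=; ring.
  rewrite ep2; transitivity ((a ^+ 2 + b ^+ 2) * dot w w); first by rewrite /dot; ring.
  by rewrite detE mul1r.
have [finv fK1 fK2] := planar_map_bij D0.
have pU u : U u -> dot p u <= 0.
  move=> uU; have u1 := Uunit uU.
  have := sub (finv u) u _ uU; rewrite fK2.
  have -> : dot (p + u) u = dot p u + dot u u by rewrite /dot /=; ring.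
  rewrite u1 => h; have : dot p u + 1 <= 1; last by lra.
  by apply: h; apply/unit_discE; rewrite -isom fK2 u1.
have p0 : p = 0.
  apply: dot_eq0; apply/eqP; rewrite eq_le dot_ge0 andbT.
  pose n := Num.sqrt (dot p p).
  have : 0 <= 2 * 0 * n + dot (- p.1, - p.2) p.
    apply: (john_set_prod qU) => u uU; have u1 := Uunit uU; apply: mulr_ge0.
      by have := pU _ uU; rewrite /dot /=; lra.
    suff : - dot p u <= n by rewrite /dot; lra.
    apply: le_trans (ler_norm _) _; rewrite normrN -sqrtr_sqr; apply: ler_wsqrtr.
    by apply: le_trans (cauchy_schwarz _ _) _; rewrite u1 mulr1.
  by rewrite /dot /=; lra.
apply/seteqP; split => [_ [w /unit_discE w1 <-]|z /unit_discE z1].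
  by rewrite p0 add0r; apply/unit_discE; rewrite isom.
exists (finv z); last by rewrite p0 add0r fK2.
by apply/unit_discE; rewrite -isom fK2.
Qed.

(** The value chosen by the definite description is an ellipse of maximal area,
    and the preceding lemma leaves only the disc. *)
Theorem john_sufficiency (K : set (R * R)) : @unit_disc R `<=` K ->
  (forall z u, K z -> U u -> dot z u <= 1) ->
  john_ellipse K = @unit_disc R.
Proof.
move=> BK KU; have [a0 aoo] := area_unit_disc R.
have afin : area (@unit_disc R) \is a fin_num by rewrite ge0_fin_numE// ltW.
have ellB : ellipse (@unit_disc R).
  exists 0, idfun; split; first by exists idfun.
  by apply/seteqP; split => [u uB|_ [u uB <-]]; [exists u => //|]; rewrite add0r.
have EP E : ellipse E -> E `<=` K ->
   (area E <= area (@unit_disc R))%E /\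
   ((area (@unit_disc R) <= area E)%E -> E = @unit_disc R).
  move=> [p [f [fbij ->]]] EK.
  have fE : (f : R * R -> R * R) = planar_map (f (1, 0)).1 (f (0, 1)).1 (f (1, 0)).2 (f (0, 1)).2.
    by apply/funext => z; rewrite {1}linear_planar_mapE.
  move: fbij EK; rewrite fE.
  set a := (f (1, 0)).1; set b := (f (0, 1)).1; set g := (f (1, 0)).2; set d := (f (0, 1)).2.
  move=> /bij_planar_map D0 EK.
  have [|d1 d2] := @ellipse_in_polar p a b g d D0.
    by move=> w u wB uU; apply: KU => //; apply: EK; exists w.
  rewrite area_ellipse// -(fineK afin) -EFinM !lee_fin.
  have f0 : 0 < fine (area (@unit_disc R)) by rewrite -lte_fin fineK.
  rewrite -[X in _ <= X]mul1r ler_pM2r//; split => //.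
  by rewrite -[X in X <= _]mul1r ler_pM2r.
have mB : max_area_ellipse K (@unit_disc R).
  by split => // E' eE' E'K; have [] := EP _ eE' E'K.
rewrite /john_ellipse; case: xgetP => [E -> [eE EK maxE]|/(_ (@unit_disc R))//].
by have [_] := EP _ eE EK; apply; exact: maxE.
Qed.

End sufficiency.

(** * Inequalities between the Gram entries *)

Lemma inner_root_gt0 (R : realType) (s W : R) : 0 <= W ->
  W ^+ 2 = 4 * (2 - s) ^+ 2 + (s ^+ 2 - 1) ^+ 2 -> 0 < W.
Proof.
move=> W0 WE; rewrite lt_neqAle W0 andbT eq_sym; apply/eqP => W00; move: WE.
rewrite W00 expr0n /= => E.
have /eqP : (2 - s) ^+ 2 = 0 by have := sqr_ge0 (2 - s); have := sqr_ge0 (s ^+ 2 - 1); lra.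
rewrite sqrf_eq0 => /eqP s20; have sE : s = 2 by lra.
by move: E; rewrite sE; lra.
Qed.

(** The difference of the squares is [8 (s - 1)^2 (2 - s) (s + 1)]. *)
Lemma inner_root_ge (R : realType) (s W : R) : 1 <= s -> s <= 2 -> 0 <= W ->
  W ^+ 2 = 4 * (2 - s) ^+ 2 + (s ^+ 2 - 1) ^+ 2 ->
  4 * s + 1 - 3 * s ^+ 2 <= W /\
  (W = 4 * s + 1 - 3 * s ^+ 2 -> s = 1).
Proof.
move=> s1 s2 W0 WE; have E : W ^+ 2 - (4 * s + 1 - 3 * s ^+ 2) ^+ 2 =
    8 * ((s - 1) ^+ 2 * ((2 - s) * (s + 1))) by rewrite WE; ring.
split.
  rewrite leNgt; apply/negP => h.
  have : W ^+ 2 < (4 * s + 1 - 3 * s ^+ 2) ^+ 2.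
    by rewrite ltr_pXn2r// nnegrE; lra.
  have : 0 <= (s - 1) ^+ 2 * ((2 - s) * (s + 1)).
    by apply: mulr_ge0; [exact: sqr_ge0|apply: mulr_ge0; lra].
  lra.
move=> WE'; have : (s - 1) ^+ 2 * ((2 - s) * (s + 1)) = 0.
  by move: E; rewrite -WE'; lra.
move/eqP; rewrite mulf_eq0 sqrf_eq0 mulf_eq0 => /orP[/eqP s10|/orP[/eqP s20|/eqP]]; [lra| |lra].
have sE : s = 2 by lra.
by move: WE' W0; rewrite sE; lra.
Qed.

(** Bounds the effect of unequal norms: [d] cannot exceed [s^2 - 1], because
    [p <= 2s] and the distance is large. *)
Lemma spread_ge0 (R : realType) (s W p r t : R) :
  1 <= s -> s <= 2 -> 0 <= W ->
  W ^+ 2 = 4 * (2 - s) ^+ 2 + (s ^+ 2 - 1) ^+ 2 ->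
  r <= p -> p <= 2 * s -> t <= 2 -> s ^+ 2 + 5 + W <= p + r + 2 * t ->
  let d := (p - r) / 2 in
  0 <= d * (s ^+ 2 - 1 - d) /\ (d * (s ^+ 2 - 1 - d) = 0 -> p = r).
Proof.
move=> s1 s2 W0 WE rp ps t2 Dq d.
have [Wl Weq] := inner_root_ge s1 s2 W0 WE.
have d0 : 0 <= d by rewrite /d; lra.
split; first by apply: mulr_ge0 => //; rewrite /d; lra.
move/eqP; rewrite mulf_eq0 => /orP[/eqP|/eqP]; rewrite /d => h; first lra.
have /Weq sE : W = 4 * s + 1 - 3 * s ^+ 2 by lra.
by move: h; rewrite sE; lra.
Qed.

(** The squared norm of the endpoints in the extremal configuration, as a root
    of the quadratic expressing that the value pair [(-s, 1)] lies on the
    ellipse traced by the circle. *)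
Lemma extremal_norm_root (R : realType) (s W : R) :
  W ^+ 2 = 4 * (2 - s) ^+ 2 + (s ^+ 2 - 1) ^+ 2 ->
  let rs := (s ^+ 2 + 1 + W) / 2 in
  rs ^+ 2 - (1 + s ^+ 2) * rs + 4 * s - 4 = 0.
Proof.
move=> WE rs.
have : (2 * rs - (s ^+ 2 + 1)) ^+ 2 = 4 * (2 - s) ^+ 2 + (s ^+ 2 - 1) ^+ 2.
  by rewrite -WE /rs; congr (_ ^+ 2); lra.
lra.
Qed.

(** The two sides differ by the quadratic of the previous lemma, evaluated at
    the mean of [p] and [r], plus the nonnegative effect of [p <> r]; its root
    is at most that mean because [t <= 2]. *)
Lemma overlap_margin (R : realType) (s W p r t : R) :
  1 <= s -> s <= 2 -> 0 <= W ->
  W ^+ 2 = 4 * (2 - s) ^+ 2 + (s ^+ 2 - 1) ^+ 2 ->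
  r <= p -> p <= 2 * s -> t <= 2 -> s ^+ 2 + 5 + W <= p + r + 2 * t ->
  p + 4 - 4 * s <= r * (p - s ^+ 2).
Proof.
move=> s1 s2 W0 WE rp ps t2 Dq.
have [h3 _] := spread_ge0 s1 s2 W0 WE rp ps t2 Dq.
have /= h2 := extremal_norm_root WE; have Wp := inner_root_gt0 W0 WE.
set d := (p - r) / 2 in h3; set rs := (s ^+ 2 + 1 + W) / 2 in h2.
pose rho := (p + r) / 2.
have h1 : rs <= rho by rewrite /rho /rs; lra.
have h4 : r * (p - s ^+ 2) - (p + 4 - 4 * s) =
    (rho - rs) * (rho - rs + W) + (rs ^+ 2 - (1 + s ^+ 2) * rs + 4 * s - 4)
    + d * (s ^+ 2 - 1 - d) by rewrite /rho /d /rs; field.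
have : 0 <= (rho - rs) * (rho - rs + W) by apply: mulr_ge0; lra.
lra.
Qed.

(** The last premise makes a sum of nonnegative terms nonpositive.  The terms
    contain the excess [x] of the mean norm, the defect [tau] of [t] from 2 and
    the effect of [p <> r]. *)
Lemma no_overlap_tight (R : realType) (s W p r t : R) :
  1 <= s -> s <= 2 -> 0 <= W ->
  W ^+ 2 = 4 * (2 - s) ^+ 2 + (s ^+ 2 - 1) ^+ 2 ->
  r <= p -> p <= 2 * s -> t <= 2 -> s ^+ 2 + 5 + W <= p + r + 2 * t ->
  p * r - t ^+ 2 <= r * s ^+ 2 - 2 * t * s + p ->
  [/\ t = 2, p = r & 2 * p = s ^+ 2 + 1 + W].
Proof.
move=> s1 s2 W0 WE rp ps t2 Dq h4.
have [h3 h3'] := spread_ge0 s1 s2 W0 WE rp ps t2 Dq.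
have /= h2 := extremal_norm_root WE; have Wp := inner_root_gt0 W0 WE.
set d := (p - r) / 2 in h3 h3'; set rs := (s ^+ 2 + 1 + W) / 2 in h2.
pose rho := (p + r) / 2; pose tau := 2 - t; pose x := rho - (rs + tau).
have E : p * r - t ^+ 2 - (r * s ^+ 2 - 2 * t * s + p) =
   (rs ^+ 2 - (1 + s ^+ 2) * rs + 4 * s - 4)
   + x * W + (x ^+ 2 + 2 * (x * tau)) + tau * (W + 2 * (2 - s))
   + d * (s ^+ 2 - 1 - d) by rewrite /x /rho /d /rs /tau; field.
have x0 : 0 <= x by rewrite /x /rho /rs /tau; lra.
have tau0 : 0 <= tau by rewrite /tau; lra.
have a1 : 0 <= x * W by apply: mulr_ge0.
have a2 : 0 <= x ^+ 2 + 2 * (x * tau).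
  by apply: addr_ge0; [exact: sqr_ge0|rewrite mulr_ge0// mulr_ge0].
have a3 : 0 <= tau * (W + 2 * (2 - s)) by apply: mulr_ge0 => //; lra.
have {}E : x * W + (x ^+ 2 + 2 * (x * tau)) + tau * (W + 2 * (2 - s))
   + d * (s ^+ 2 - 1 - d) <= 0 by lra.
have /h3' pr : d * (s ^+ 2 - 1 - d) = 0 by lra.
have : x * W = 0 by lra.
move/eqP; rewrite mulf_eq0 (gt_eqF Wp) orbF => /eqP xE.
have : tau * (W + 2 * (2 - s)) = 0 by lra.
have X0 : 0 < W + 2 * (2 - s) by lra.
move/eqP; rewrite mulf_eq0 (gt_eqF X0) orbF.
move/eqP => tE; split => //; first by move: tE; rewrite /tau; lra.
by move: xE; rewrite /x tE /rho /rs pr; lra.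
Qed.

(** * Arcs without contact points *)

(** In the half-angle coordinate [u = d / (1 + c)] the conclusion is
    [(u + T) (u - t2) >= 0] up to a positive factor, the condition [P c <= s] is
    [T^2 <= u^2], and [k c + e d <= 1] says that a concave quadratic in [u],
    positive at [T] and [t2] by hypothesis, is nonpositive.  So [u] avoids the
    open interval from [-T] to [t2]. *)
Lemma half_angle_certificate (R : realType) (P s k e T t2 c d : R) :
  0 < P -> 1 <= s -> 0 <= k -> 0 < T -> 0 < t2 -> T ^+ 2 * (P + s) = P - s ->
  0 < - (1 + k) * T ^+ 2 + 2 * e * T + (k - 1) ->
  0 < - (1 + k) * t2 ^+ 2 + 2 * e * t2 + (k - 1) ->
  c ^+ 2 + d ^+ 2 = 1 -> P * c <= s -> k * c + e * d <= 1 ->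
  0 <= (1 - T * t2) - (1 + T * t2) * c + (T - t2) * d.
Proof.
move=> P0 s1 k0 T0 t20 TE gT gt2 cd Pc b1.
have [c1|c1] := eqVneq c (-1).
  have d0 : d = 0 by apply/eqP; rewrite -sqrf_eq0; apply/eqP; move: cd; rewrite c1; lra.
  by rewrite c1 d0; lra.
have c1' : 0 < 1 + c.
  have : -1 <= c by rewrite -lerN2 opprK; apply: le_trans (ler_norm _) _; rewrite normrN -(@expr_le1 _ 2)// ?normr_ge0// real_normK ?num_real//; nra.
  by rewrite le_eqVlt eq_sym (negbTE c1) /= => ?; lra.
pose u := d / (1 + c).
have dE : d = u * (1 + c) by rewrite /u divfK// gt_eqF.
have uE : (1 + c) * u ^+ 2 = 1 - c.
  apply: (@mulfI _ (1 + c)); first by rewrite gt_eqF.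
  have -> : (1 + c) * ((1 + c) * u ^+ 2) = d ^+ 2 by rewrite dE; ring.
  have -> : d ^+ 2 = 1 - c ^+ 2 by rewrite -cd; ring.
  ring.
have gu : - (1 + k) * u ^+ 2 + 2 * e * u + (k - 1) <= 0.
  rewrite -(pmulr_rle0 _ c1').
  have -> : (1 + c) * (- (1 + k) * u ^+ 2 + 2 * e * u + (k - 1)) =
    - (1 + k) * ((1 + c) * u ^+ 2) + 2 * e * (u * (1 + c)) + (k - 1) * (1 + c) by ring.
  by rewrite uE -dE; lra.
have Tu : T ^+ 2 <= u ^+ 2.
  rewrite -subr_ge0 -(pmulr_rge0 _ c1') -(@pmulr_rge0 _ (P + s)); last lra.
  have -> : (P + s) * ((1 + c) * (u ^+ 2 - T ^+ 2)) =
    (P + s) * ((1 + c) * u ^+ 2) - (T ^+ 2 * (P + s)) * (1 + c) by ring.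
  by rewrite uE TE; lra.
have -> : (1 - T * t2) - (1 + T * t2) * c + (T - t2) * d =
    (1 + c) * ((u + T) * (u - t2)).
  have -> : (1 + c) * ((u + T) * (u - t2)) =
    (1 + c) * u ^+ 2 + (T - t2) * (u * (1 + c)) - T * t2 * (1 + c) by ring.
  by rewrite uE -dE; ring.
apply: mulr_ge0; first exact: ltW.
have [uT|uT] := leP u (- T); last have [ut|ut] := leP t2 u.
- by apply: mulr_le0; lra.
- by apply: mulr_ge0; lra.
- have Tu' : T <= u.
    by rewrite leNgt; apply/negP => uT'; nra.
  exfalso.
  have : 0 < (t2 - T) * (- (1 + k) * u ^+ 2 + 2 * e * u + (k - 1)).
    have -> : (t2 - T) * (- (1 + k) * u ^+ 2 + 2 * e * u + (k - 1)) =
      (t2 - u) * (- (1 + k) * T ^+ 2 + 2 * e * T + (k - 1)) +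
      (u - T) * (- (1 + k) * t2 ^+ 2 + 2 * e * t2 + (k - 1)) +
      (1 + k) * ((t2 - T) * ((u - T) * (t2 - u))) by ring.
    apply: ltr_wpDr; first by apply: mulr_ge0; [lra|apply: mulr_ge0; [lra|apply: mulr_ge0; lra]].
    apply: ltr_wpDr; first by apply: mulr_ge0; [lra|exact: ltW].
    by apply: mulr_gt0 => //; lra.
  by rewrite pmulr_rgt0 ?ltNge ?gu//; lra.
Qed.

(** In the frame with first axis along [-x], where [P] is the norm of [x] and
    [(k, e)] are the coordinates of [y], [T] and [-T] are the half-angle
    coordinates of the ends of the arc [<x,u> < -s], and [T] and [t2] lie in the
    arc [<y,u> > 1].
    The final inequality makes the mean of the certificate negative.  It becomes
    an equality at [t1], where the chord from the end [-T] of the first arc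
    passes through [-x/2]; there [<y,u> > 1] still holds strictly, which leaves room for
    [t2 > t1]. *)
Lemma half_angles_exist (R : realType) (P s k e : R) :
  let p := P ^+ 2 in let r := k ^+ 2 + e ^+ 2 in let t := k * P in
  0 < P -> 1 <= s -> s <= 2 -> 0 <= k -> 0 <= e -> p <= 2 * s -> t <= 2 ->
  p + 4 - 4 * s <= r * (p - s ^+ 2) ->
  (P - k * s) ^+ 2 < e ^+ 2 * (p - s ^+ 2) ->
  exists T t2, [/\ 0 < T, 0 < t2, T ^+ 2 * (P + s) = P - s,
    0 < - (1 + k) * T ^+ 2 + 2 * e * T + (k - 1) &
    0 < - (1 + k) * t2 ^+ 2 + 2 * e * t2 + (k - 1) /\
    2 - P < (2 + P) * (T * t2)].
Proof.
move=> p r t P0 s1 s2 k0 e0 ps t2 rps Pks.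
have ps2 : s ^+ 2 < p.
  rewrite -subr_gt0; have := le_lt_trans (sqr_ge0 _) Pks.
  rewrite le_eqVlt in e0; case/orP: e0 => [/eqP<-|e0]; first by rewrite expr0n mul0r ltxx.
  by rewrite pmulr_rgt0// exprn_gt0.
have sP : s < P by apply: lt_of_sqr_lt => //; apply: ltW.
have P2 : P < 2.
  apply: lt_of_sqr_lt; first by [].
  have : s * s < s * 2 by nra.
  by rewrite ltr_pM2l; [rewrite /p in ps ps2 *; nra | lra].
have [T [T0 TE]] : exists T, 0 < T /\ T ^+ 2 * (P + s) = P - s.
  exists (Num.sqrt ((P - s) / (P + s))); split.
    by rewrite sqrtr_gt0 divr_gt0//; lra.
  rewrite sqr_sqrtr; last by rewrite divr_ge0//; lra.
  by rewrite divfK// gt_eqF//; lra.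
have TPs : (T * (P + s)) ^+ 2 = p - s ^+ 2.
  have -> : (T * (P + s)) ^+ 2 = (T ^+ 2 * (P + s)) * (P + s) by ring.
  by rewrite TE /p; ring.
have TPs0 : 0 < T * (P + s) by apply: mulr_gt0; lra.
have gT : 0 < - (1 + k) * T ^+ 2 + 2 * e * T + (k - 1).
  rewrite -(@pmulr_lgt0 _ (P + s)); last lra.
  have -> : (- (1 + k) * T ^+ 2 + 2 * e * T + (k - 1)) * (P + s) =
     - (1 + k) * (T ^+ 2 * (P + s)) + 2 * (e * (T * (P + s))) + (k - 1) * (P + s) by ring.
  rewrite TE.
  have : P - k * s < e * (T * (P + s)).
    by apply: lt_of_sqr_lt; [apply: mulr_ge0 => //; exact: ltW|rewrite exprMn TPs].
  lra.
(* The chord from the end [-T] of the arc [<x,u> < -s] through [-x/2] meets the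
   circle again where [<x,u> = m / M]. *)
pose M := p + 4 - 4 * s; pose m := p * s + 4 * s - 4 * p.
have M0 : 0 < M by have := sqr_ge0 (s - 2); rewrite /M; nra.
have E1 : (P - s) * (P + 2) ^+ 2 = M * P - m by rewrite /M /m /p; ring.
have E2 : (P + s) * (2 - P) ^+ 2 = M * P + m by rewrite /M /m /p; ring.
have key : (M * P + k * m) ^+ 2 < (e * (4 - p) * (T * (P + s))) ^+ 2.
  have -> : (e * (4 - p) * (T * (P + s))) ^+ 2 =
     e ^+ 2 * (4 - p) ^+ 2 * (T * (P + s)) ^+ 2 by ring.
  rewrite TPs -subr_gt0.
  have -> : e ^+ 2 * (4 - p) ^+ 2 * (p - s ^+ 2) - (M * P + k * m) ^+ 2 =
    M ^+ 2 * (e ^+ 2 * (p - s ^+ 2) - (P - k * s) ^+ 2)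
    + (2 * ((2 * s - p) * (2 - s))) * (4 * (r * (p - s ^+ 2)) - 2 * (t * M)).
    by rewrite /M /m /p /r /t; ring.
  apply: ltr_wpDr; last by apply: mulr_gt0; [rewrite exprn_gt0|rewrite subr_gt0].
  apply: mulr_ge0; first by apply: mulr_ge0 => //; apply: mulr_ge0; lra.
  have : t * M <= 2 * M by rewrite ler_pM2r.
  move: rps; rewrite -/M; lra.
pose t1 := (2 - P) / ((2 + P) * T).
have D0 : 0 < (2 + P) * T by apply: mulr_gt0; lra.
have t1E : t1 * ((2 + P) * T) = 2 - P by rewrite /t1 divfK// gt_eqF.
have t10 : 0 < t1 by rewrite /t1 divr_gt0//; lra.
have gt1 : 0 < - (1 + k) * t1 ^+ 2 + 2 * e * t1 + (k - 1).
  have D2 : 0 < ((2 + P) * T) ^+ 2 * (P + s) by apply: mulr_gt0; [rewrite exprn_gt0|lra].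
  rewrite -(pmulr_lgt0 _ D2).
  have -> : (- (1 + k) * t1 ^+ 2 + 2 * e * t1 + (k - 1)) * (((2 + P) * T) ^+ 2 * (P + s)) =
    - (1 + k) * ((P + s) * (t1 * ((2 + P) * T)) ^+ 2)
    + 2 * (e * (2 + P) * (t1 * ((2 + P) * T)) * (T * (P + s)))
    + (k - 1) * (T ^+ 2 * (P + s) * (P + 2) ^+ 2) by ring.
  rewrite t1E TE E1 E2.
  have : M * P + k * m < e * (4 - p) * (T * (P + s)).
    apply: lt_of_sqr_lt key; apply: mulr_ge0; last exact: ltW.
    by apply: mulr_ge0 => //; rewrite /p; nra.
  have -> : e * (4 - p) * (T * (P + s)) = e * (2 + P) * (2 - P) * (T * (P + s)).
    by rewrite /p; ring.
  lra.
set g1 := (X in 0 < X) in gt1.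
pose X := (1 + k) * (2 * t1 + 1).
have X0 : 0 < X by apply: mulr_gt0; lra.
(* A step small enough for the quadratic to stay positive, and at most 1. *)
pose h := g1 / (X + g1).
have h0 : 0 < h by apply: divr_gt0 => //; lra.
have hE : h * (X + g1) = g1 by rewrite /h divfK// gt_eqF//; lra.
have h1 : h < 1 by rewrite /h ltr_pdivrMr; lra.
exists T, (t1 + h); split => //; first by lra.
split.
  have -> : - (1 + k) * (t1 + h) ^+ 2 + 2 * e * (t1 + h) + (k - 1) =
    g1 + 2 * (e * h) - h * X + (1 + k) * (h * (1 - h)) by rewrite /g1 /X; ring.
  have : 0 <= (1 + k) * (h * (1 - h)) by apply: mulr_ge0; [lra|apply: mulr_ge0; lra].
  have : 0 <= e * h by apply: mulr_ge0 => //; exact: ltW.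
  have : 0 < h * g1 by apply: mulr_gt0.
  move: hE; rewrite mulrDr; lra.
have : 0 < h * ((2 + P) * T) by apply: mulr_gt0.
by move: t1E; lra.
Qed.

(** * Diameter of the slab body *)

(** With [U] the contact points, this is the part of the plane to which John
    position and the asymmetry [s] confine a body. *)
Definition slab (R : realType) (U : set (R * R)) (s : R) : set (R * R) :=
  [set x | forall u, U u -> - s <= dot x u <= 1].

Section core.
Variables (R : realType) (U : set (R * R)) (s : R).
Hypotheses (Uunit : forall u, U u -> dot u u = 1) (UJ : john_set U).

Lemma john_norm x : slab U s x -> dot x x <= 2 * s.
Proof.
move=> sx; have : 0 <= 2 * s * 1 + dot x (- x.1, - x.2).
  apply: (john_set_prod UJ) => u /sx/andP[h1 h2]; apply: mulr_ge0; first by rewrite -lerBlDl sub0r.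
  by move: h2; rewrite /dot /=; lra.
by rewrite /dot /=; lra.
Qed.

Lemma john_dot x y : slab U s x -> slab U s y -> - 2 <= dot x y.
Proof.
move=> sx sy; have : 0 <= 2 * 1 * 1 + dot (- x.1, - x.2) (- y.1, - y.2).
  by apply: (john_set_prod UJ) => u uU; move/andP: (sx _ uU) => [_ h1]; move/andP: (sy _ uU) => [_ h2];
    apply: mulr_ge0; move: h1 h2; rewrite /dot /=; lra.
by rewrite /dot /=; lra.
Qed.

(** The conclusion says that the value pair [(-s, 1)] of [(<x,u>, <y,u>)] is not
    strictly inside the ellipse traced by the unit circle.  If it were, the arcs
    [<x,u> < -s] and [<y,u> > 1] would overlap and neither would contain the
    other; the chord cutting off most of their union then separates
    all contact points from [-x/2].  But [-x/2] is a mean of contact points,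
    namely with weights proportional to [1 - <x,u>]. *)
Lemma no_overlap x y : 1 <= s -> s <= 2 ->
  slab U s x -> slab U s y -> dot x y <= 0 ->
  dot x x + 4 - 4 * s <= dot y y * (dot x x - s ^+ 2) ->
  dot x x * dot y y - dot x y ^+ 2 <=
    dot y y * s ^+ 2 + 2 * dot x y * s + dot x x.
Proof.
move=> s1 s2 sx sy xy hov; rewrite leNgt; apply/negP => hin.
have xs := john_norm sx; have xy2 := john_dot sx sy.
pose cr := x.1 * y.2 - x.2 * y.1.
have crE : cr ^+ 2 = dot x x * dot y y - dot x y ^+ 2 by rewrite /cr /dot; ring.
have x0 : 0 < dot x x.
  rewrite lt_neqAle eq_sym; apply/andP; split; last by rewrite addr_ge0// -expr2 sqr_ge0.
  apply/eqP => xx0; have : cr ^+ 2 = 0.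
    apply/eqP; rewrite eq_le sqr_ge0 andbT crE xx0 mul0r sub0r oppr_le0; exact: sqr_ge0.
  have yy : 0 <= dot y y * s ^+ 2.
    by rewrite mulr_ge0 ?sqr_ge0// addr_ge0// -expr2 sqr_ge0.
  rewrite crE => E; move: hin; rewrite E xx0.
  have : dot x y = 0; last by move=> ->; lra.
  by apply/eqP; rewrite -sqrf_eq0; apply/eqP; move: E; rewrite xx0 mul0r; lra.
pose P := Num.sqrt (dot x x).
have P0 : 0 < P by rewrite sqrtr_gt0.
have PE : P ^+ 2 = dot x x by rewrite sqr_sqrtr// ltW.
(* The sign orients the second axis towards [y]. *)
have [ep [ep2 epc]] : exists ep, ep ^+ 2 = 1 /\ 0 <= ep * cr.
  by case: (leP 0 cr) => h; [exists 1|exists (-1)]; split; lra.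
pose k := - dot x y / P; pose e := ep * cr / P.
have kE : k * P = - dot x y by rewrite /k divfK// gt_eqF.
have eE : e * P = ep * cr by rewrite /e divfK// gt_eqF.
have k0 : 0 <= k by rewrite /k divr_ge0 ?oppr_ge0// ltW.
have e0 : 0 <= e by rewrite /e divr_ge0// ltW.
have rE : k ^+ 2 + e ^+ 2 = dot y y.
  apply: (@mulIf _ (P ^+ 2)); first by rewrite gt_eqF// exprn_gt0.
  have -> : (k ^+ 2 + e ^+ 2) * P ^+ 2 = (k * P) ^+ 2 + (e * P) ^+ 2 by ring.
  by rewrite kE eE exprMn ep2 crE PE; ring.
have [||||T [t2 [T0 t20 TE gT [gt2 Tt2]]]] := @half_angles_exist R P s k e P0 s1 s2 k0 e0.
- by rewrite PE.
- by rewrite kE; lra.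
- by rewrite PE rE.
- rewrite -subr_gt0.
  have -> : e ^+ 2 * (P ^+ 2 - s ^+ 2) - (P - k * s) ^+ 2 =
     e ^+ 2 * P ^+ 2 - (k ^+ 2 + e ^+ 2) * s ^+ 2 + 2 * (k * P) * s - P ^+ 2 by ring.
  rewrite rE kE -[e ^+ 2 * _]exprMn eE exprMn ep2 crE PE.
  by move: hin; lra.
(* [f1] and [f2] are the frame vectors, and [1 - T t2 + <w,u>] is the affine
   function vanishing at the half-angle coordinates [-T] and [t2]. *)
pose v : R * R := (- x.1, - x.2).
pose f1 : R * R := (- x.1 / P, - x.2 / P).
pose f2 : R * R := (- ep * x.2 / P, ep * x.1 / P).
pose w : R * R := (- (1 + T * t2) * f1.1 + (T - t2) * f2.1,
                   - (1 + T * t2) * f1.2 + (T - t2) * f2.2).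
have : 0 <= 2 * 1 * (1 - T * t2) + dot v w.
  apply: (john_set_prod UJ) => u uU.
  have /andP[xu1 xu2] := sx _ uU; have /andP[yu1 yu2] := sy _ uU.
  have f1u : dot f1 u * P = - dot x u by rewrite /dot /=; field; rewrite gt_eqF.
  have f2u : dot f2 u * P = ep * (x.1 * u.2 - x.2 * u.1).
    by rewrite /dot /=; field; rewrite gt_eqF.
  apply: mulr_ge0; first by move: xu2; rewrite /dot /=; lra.
  have -> : 1 - T * t2 + dot w u =
    (1 - T * t2) - (1 + T * t2) * dot f1 u + (T - t2) * dot f2 u.
    by rewrite /dot /w /=; ring.
  apply: (half_angle_certificate P0 s1 k0 T0 t20 TE gT gt2).
  - apply: (@mulIf _ (P ^+ 2)); first by rewrite gt_eqF// exprn_gt0.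
    rewrite mulrDl -!exprMn f1u f2u exprMn ep2 mul1r PE.
    by rewrite -[RHS](mulr1) -{2}(Uunit uU) /dot; ring.
  - by rewrite mulrC f1u; lra.
  - apply: le_trans yu2; rewrite le_eqVlt; apply/orP; left; apply/eqP.
    apply: (@mulIf _ (P ^+ 2)); first by rewrite gt_eqF// exprn_gt0.
    have -> : (k * dot f1 u + e * dot f2 u) * P ^+ 2 =
      (k * P) * (dot f1 u * P) + (e * P) * (dot f2 u * P) by ring.
    rewrite kE eE f1u f2u PE.
    have -> : ep * cr * (ep * (x.1 * u.2 - x.2 * u.1)) = ep ^+ 2 * (cr * (x.1 * u.2 - x.2 * u.1)) by ring.
    by rewrite ep2 /cr /dot; ring.
have -> : dot v w = - P * (1 + T * t2).
  apply: (@mulIf _ P); first by rewrite gt_eqF.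
  have -> : - P * (1 + T * t2) * P = - P ^+ 2 * (1 + T * t2) by ring.
  by rewrite PE /dot /v /w /f1 /f2 /=; field; rewrite gt_eqF.
by move: Tt2; lra.
Qed.

End core.

(** The bound and its equality case, for [x] and [y] confined by the contact
    points alone. *)
Theorem slab_diameter (R : realType) (U : set (R * R)) (s W : R) x y :
  (forall u, U u -> dot u u = 1) -> john_set U ->
  1 <= s -> s <= 2 -> 0 <= W ->
  W ^+ 2 = 4 * (2 - s) ^+ 2 + (s ^+ 2 - 1) ^+ 2 ->
  slab U s x -> slab U s y ->
  s ^+ 2 + 5 + W <= dot x x + dot y y - 2 * dot x y ->
  [/\ dot x y = - 2, 2 * dot x x = s ^+ 2 + 1 + W & 2 * dot y y = s ^+ 2 + 1 + W].
Proof.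
move=> Uu UJ s1 s2 W0 WE; wlog yx : x y / dot y y <= dot x x.
  move=> IH sx sy h; have [yx|/ltW xy] := leP (dot y y) (dot x x); first exact: IH.
  have dC : dot y x = dot x y by rewrite /dot; ring.
  have [|? ? ?] := IH y x xy sy sx; first by rewrite dC; lra.
  by split=> //; rewrite -dC.
move=> sx sy h.
have xs := john_norm UJ sx; have ys := john_norm UJ sy; have xy2 := john_dot UJ sx sy.
have t2 : - dot x y <= 2 by lra.
have h' : s ^+ 2 + 5 + W <= dot x x + dot y y + 2 * - dot x y by lra.
have hov := overlap_margin s1 s2 W0 WE yx xs t2 h'.
have xy0 : dot x y <= 0 by have := sqr_ge0 (s - 2); lra.
have hn := no_overlap Uu UJ s1 s2 sx sy xy0 hov.
have [|tE xyE xE] := no_overlap_tight s1 s2 W0 WE yx xs t2 h'.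
  by rewrite sqrrN; lra.
by split; rewrite -?xyE; lra.
Qed.

(** * Bodies whose John ellipse is the disc *)

Lemma john_ellipse_max (R : realType) (K : set (R * R)) :
  john_ellipse K = @unit_disc R -> max_area_ellipse K (@unit_disc R).
Proof.
rewrite /john_ellipse; case: xgetP => [E -> /= mE <-//|_ /seteqP[_ /(_ 0)]].
by case; apply/unit_discE; rewrite /dot /= mulr0 addr0.
Qed.

(** A disc centered at the origin is symmetric about the center of any ellipse
    that it equals; reflecting the point opposite to [c] leaves the disc unless
    [c] is 0. *)
Lemma unit_disc_center (R : realType) (c : R * R) : ellipse_at c (@unit_disc R) -> c = 0.
Proof.
move=> [f [_ E]]; apply: dot_eq0; apply/eqP; rewrite eq_le dot_ge0 andbT leNgt.
apply/negP => c0; pose n := Num.sqrt (dot c c).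
have n0 : 0 < n by rewrite sqrtr_gt0.
have nE : n ^+ 2 = dot c c by rewrite sqr_sqrtr// ltW.
pose x : R * R := (- (c.1 / n), - (c.2 / n)).
have xB : unit_disc x.
  apply/unit_discE; rewrite (_ : dot x x = dot c c / n ^+ 2); last first.
    by rewrite /x /dot /=; field; rewrite gt_eqF.
  by rewrite nE divff// gt_eqF.
have : unit_disc (2 * c.1 - x.1, 2 * c.2 - x.2).
  move: xB; rewrite E => -[u uB <-]; exists (- u).
    by move: uB => /unit_discE h; apply/unit_discE; move: h; rewrite /dot /= !mulrNN.
  by rewrite linearN; apply: injective_projections; rewrite /=; ring.
move=> /unit_discE; have -> : dot (2 * c.1 - x.1, 2 * c.2 - x.2) (2 * c.1 - x.1, 2 * c.2 - x.2)
   = (2 * n + 1) ^+ 2.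
  transitivity (dot c c * (2 + n^-1) ^+ 2); first by rewrite /x /dot /=; ring.
  by rewrite -nE; field; rewrite gt_eqF.
by nra.
Qed.

Lemma john_center0 (R : realType) (K : set (R * R)) :
  john_ellipse K = @unit_disc R -> john_center K = 0.
Proof.
rewrite /john_center => ->; case: xgetP => [c _ /unit_disc_center//|/(_ 0)[]].
exists idfun; split; first by exists idfun.
by apply/seteqP; split => [u uB|_ [u uB <-]]; [exists u => //|]; rewrite add0r.
Qed.

(** The inclusion of [K] in [- rho K]. *)
Definition scaled_reflection (R : realType) (K : set (R * R)) (rho : R) :=
  forall x, K x -> exists2 k, K k & x = (- (rho * k.1), - (rho * k.2)).

Lemma john_asymmetryE (R : realType) (K : set (R * R)) :
  john_ellipse K = @unit_disc R ->
  john_asymmetry K = inf [set rho | 0 <= rho /\ scaled_reflection K rho].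
Proof.
move=> /john_center0 c0; rewrite /john_asymmetry c0; congr inf.
have sE (rho : R) (k : R * R) : rho *: (0 - k) = (- (rho * k.1), - (rho * k.2)).
  by apply: injective_projections; rewrite /= -[_ *: _]/(_ * _); ring.
apply/seteqP; split => rho [rho0 h]; split => //.
  move=> x Kx; have [|k Kk kE] := h x; first by exists x => //; rewrite subr0.
  by exists k => //; rewrite -sE kE.
by move=> _ [x Kx <-]; have [k Kk ->] := h x Kx; exists k => //; rewrite sE subr0.
Qed.

Section asymmetry.
Variables (R : realType) (K : set (R * R)).
Hypotheses (bK : convex_body K) (jK : john_ellipse K = @unit_disc R).

Let mK := john_ellipse_max jK.
Let BK : @unit_disc R `<=` K. Proof. by case: mK. Qed.
Let K0 : K !=set0.
Proof. by exists 0; apply: BK; apply/unit_discE; rewrite /dot /= mulr0 addr0. Qed.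

(** Compare the farthest point of [K] from the origin with its preimage. *)
Lemma scaled_reflection_ge1 rho : 0 <= rho -> scaled_reflection K rho -> 1 <= rho.
Proof.
move=> rho0 h; case: bK => cK _ _.
have [|z /set_mem Kz zmax] := @compact_EVT_max _ _ (fun z : R * R => 0 * z.1 + 0 * z.2 + 1 * z.1 ^+ 2 +
   0 * (z.1 * z.2) + 1 * z.2 ^+ 2 + 0 : R) K K0 cK.
  by apply: continuous_subspaceT; exact: continuous_quadratic.
have {}zmax x : K x -> dot x x <= dot z z.
  by move=> /mem_set /zmax; rewrite /dot; lra.
have z1 : 1 <= dot z z.
  have : K (1, 0) by apply: BK; apply/unit_discE; rewrite /dot /=; lra.
  by move/zmax; rewrite {1}/dot /=; lra.
have [k Kk zE] := h z Kz.
have zz : dot z z = rho ^+ 2 * dot k k by rewrite zE /dot /=; ring.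
have : dot z z <= rho ^+ 2 * dot z z.
  by rewrite {1}zz; apply: ler_wpM2l; [exact: sqr_ge0|exact: zmax].
rewrite -[X in X <= _]mul1r ler_pM2r; last lra.
by rewrite expr_ge1.
Qed.

(** If [-x/2] were separated from [K] by the direction [v], with [k] extremal
    in [K] in that direction, then [(1 - <x,u>) (<k,v> - <u,v>)] would be
    nonnegative on the contact points but have negative mean. *)
Lemma scaled_reflection2 : scaled_reflection K 2.
Proof.
move=> x Kx; exists (- x.1 / 2, - x.2 / 2); last first.
  by apply: injective_projections; rewrite /=; field.
apply: contrapT => nK; case: (bK) => cK vK _.
have [v [v1 sep]] := separation cK vK K0 nK.
have [|k /set_mem Kk kmax] := @compact_EVT_max _ _ (fun z : R * R => v.1 * z.1 + v.2 * z.2 + 0 : R) K K0 cK.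
  by apply: continuous_subspaceT; exact: continuous_affine.
have {}kmax y : K y -> dot y v <= dot k v.
  by move=> /mem_set /kmax; rewrite /dot; lra.
have : 0 <= 2 * 1 * dot k v + dot (- x.1, - x.2) (- v.1, - v.2).
  apply: (john_set_prod (contact_john_set bK mK)) => u [u1 uK]; apply: mulr_ge0.
    by have := uK x Kx; rewrite /dot /=; lra.
  have /kmax : K u by apply: BK; apply/unit_discE; rewrite u1.
  by rewrite /dot /=; lra.
by have := sep k Kk; rewrite /dot /=; lra.
Qed.

Lemma asymmetry_bounds : 1 <= john_asymmetry K <= 2.
Proof.
rewrite john_asymmetryE//; apply/andP; split.
  apply: lb_le_inf; first by exists 2; split => //; exact: scaled_reflection2.
  by move=> rho [r0 /scaled_reflection_ge1]; exact.
apply: ge_inf; last by split => //; exact: scaled_reflection2.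
by exists 0 => rho [].
Qed.

Lemma body_slab : K `<=` slab (contact K) (john_asymmetry K).
Proof.
move=> x Kx u [u1 uK]; apply/andP; split; last exact: uK.
rewrite lerNl john_asymmetryE//; apply: lb_le_inf.
  by exists 2; split => //; exact: scaled_reflection2.
move=> rho [r0 h]; have [k Kk ->] := h x Kx.
have := uK k Kk; rewrite /dot /= => h1.
have : rho * (k.1 * u.1 + k.2 * u.2) <= rho * 1 by apply: ler_wpM2l.
lra.
Qed.

End asymmetry.

Section diam_bound.
Variables (R : realType) (s : R).
Let W := Num.sqrt (4 * (2 - s) ^+ 2 + (s ^+ 2 - 1) ^+ 2).

Lemma inner_root_sqr : W ^+ 2 = 4 * (2 - s) ^+ 2 + (s ^+ 2 - 1) ^+ 2.
Proof. by rewrite sqr_sqrtr// addr_ge0 ?sqr_ge0// mulr_ge0// sqr_ge0. Qed.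

Lemma john_diam_bound_sqr : john_diam_bound s ^+ 2 = s ^+ 2 + 5 + W.
Proof. by rewrite /john_diam_bound sqr_sqrtr// !addr_ge0// ?sqr_ge0// sqrtr_ge0. Qed.

(** Makes the radicands in the description of the equality case nonnegative. *)
Lemma john_diam_bound_sqr_ge8 : s <= 2 -> 8 <= john_diam_bound s ^+ 2.
Proof.
move=> s2; rewrite john_diam_bound_sqr.
have : 2 * (2 - s) <= W.
  rewrite -(@ler_pXn2r _ 2)// ?nnegrE ?sqrtr_ge0//; last by lra.
  by rewrite inner_root_sqr; have := sqr_ge0 (s ^+ 2 - 1); lra.
by have := sqr_ge0 (s - 1); lra.
Qed.

Lemma john_diam_bound_ge0 : 0 <= john_diam_bound s.
Proof. exact: sqrtr_ge0. Qed.

End diam_bound.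

Section main.
Variables (R : realType) (K : set (R * R)).
Hypotheses (bK : convex_body K) (jK : john_ellipse K = @unit_disc R).
Let s := john_asymmetry K.

Lemma pair_distance x y : K x -> K y ->
  john_diam_bound s ^+ 2 <= dot (x - y) (x - y) ->
  [/\ dot x y = - 2, dot x x = 2^-1 * john_diam_bound s ^+ 2 - 2 &
      dot y y = 2^-1 * john_diam_bound s ^+ 2 - 2].
Proof.
move=> Kx Ky; have /andP[s1 s2] := asymmetry_bounds bK jK.
have bs := body_slab bK jK; have jd := contact_john_set bK (john_ellipse_max jK).
have uc u : contact K u -> dot u u = 1 by case.
rewrite john_diam_bound_sqr => h.
have [|q1 q2 q3] := slab_diameter uc jd s1 s2 (sqrtr_ge0 _) (inner_root_sqr s) (bs _ Kx) (bs _ Ky).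
  by move: h; rewrite {1}/dot /=; rewrite /dot; lra.
by split => //; lra.
Qed.

Lemma pair_distance_le x y : K x -> K y -> enorm (x - y) <= john_diam_bound s.
Proof.
move=> Kx Ky; rewrite leNgt; apply/negP => h.
have h2 : john_diam_bound s ^+ 2 < dot (x - y) (x - y).
  by rewrite -sqr_enorm ltr_pXn2r// nnegrE ?john_diam_bound_ge0// sqrtr_ge0.
have [q1 q2 q3] := pair_distance Kx Ky (ltW h2).
have : dot (x - y) (x - y) = dot x x + dot y y - 2 * dot x y by rewrite /dot /=; ring.
lra.
Qed.

Lemma diameter_le : diameter K <= john_diam_bound s.
Proof.
have [_ BK _] := john_ellipse_max jK.
have K0 : K 0 by apply: BK; apply/unit_discE; rewrite /dot /= mulr0 addr0.
apply: ge_sup; first by exists (enorm (0 - 0 : R * R)), 0, 0.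
by move=> _ [x [y [Kx Ky ->]]]; exact: pair_distance_le.
Qed.

Lemma diameter_eq_iff x y : K x -> K y ->
  (enorm (x - y) = john_diam_bound s <->
         (enorm x = Num.sqrt (2^-1 * john_diam_bound s ^+ 2 - 2) /\
          enorm y = Num.sqrt (2^-1 * john_diam_bound s ^+ 2 - 2)) /\
         enorm (2^-1 *: (x + y)) =
           Num.sqrt (4^-1 * john_diam_bound s ^+ 2 - 2)).
Proof.
move=> Kx Ky; have /andP[s1 s2] := asymmetry_bounds bK jK.
have D8 := john_diam_bound_sqr_ge8 s2; rewrite -/s in s1 s2 D8.
have dE : dot (x - y) (x - y) = dot x x + dot y y - 2 * dot x y by rewrite /dot /=; ring.
have mE : dot (2^-1 *: (x + y)) (2^-1 *: (x + y)) = 4^-1 * (dot x x + dot y y + 2 * dot x y).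
  by rewrite /dot /= -!/(_ * _) -![_ *: _]/(_ * _); field.
split.
  move=> h; have [|q1 q2 q3] := pair_distance Kx Ky; first by rewrite -sqr_enorm h.
  rewrite !enormE q2 q3 mE; split => //; congr Num.sqrt; lra.
rewrite !enormE => -[[/eqP + /eqP +] /eqP].
rewrite !eqr_sqrt ?dot_ge0//; try lra.
move=> /eqP q2 /eqP q3 /eqP; rewrite mE q2 q3 => q1.
rewrite -[RHS]ger0_norm ?john_diam_bound_ge0// -sqrtr_sqr; congr Num.sqrt.
by rewrite dE q2 q3; lra.
Qed.

End main.

(** * Extremal bodies *)

Definition trapezoid (R : realType) (c1 s1 c2 s2 : R) : set (R * R) :=
  [set u | [\/ u = (c1, - s1), u = (- c1, - s1), u = (c2, s2) | u = (- c2, s2)]].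

(** The weights [s2] on the lower and [s1] on the upper vertices make the mean
    vanish; the second moment is then the identity exactly when
    [2 s1 s2 = 1]. *)
Lemma trapezoid_john_set (R : realType) (c1 s1 c2 s2 : R) :
  0 < s1 -> 2 * s1 * s2 = 1 -> c1 ^+ 2 + s1 ^+ 2 = 1 -> c2 ^+ 2 + s2 ^+ 2 = 1 ->
  john_set (trapezoid c1 s1 c2 s2).
Proof.
move=> s10 ss h1 h2 a b m11 m12 m22 pos.
have s20 : 0 < s2 by rewrite -(pmulr_rgt0 _ s10); lra.
have p1 : trapezoid c1 s1 c2 s2 (c1, - s1) by constructor 1.
have p2 : trapezoid c1 s1 c2 s2 (- c1, - s1) by constructor 2.
have p3 : trapezoid c1 s1 c2 s2 (c2, s2) by constructor 3.
have p4 : trapezoid c1 s1 c2 s2 (- c2, s2) by constructor 4.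
move: (pos _ p1) (pos _ p2) (pos _ p3) (pos _ p4); rewrite /dot /= => {}p1 {}p2 {}p3 {}p4.
have q1 : 0 <= a - b.2 * s1 + m11 * c1 ^+ 2 + m22 * s1 ^+ 2 by lra.
have q2 : 0 <= a + b.2 * s2 + m11 * c2 ^+ 2 + m22 * s2 ^+ 2 by lra.
have : 0 <= s2 * (a - b.2 * s1 + m11 * c1 ^+ 2 + m22 * s1 ^+ 2) +
  s1 * (a + b.2 * s2 + m11 * c2 ^+ 2 + m22 * s2 ^+ 2).
  by apply: addr_ge0; apply: mulr_ge0 => //; exact: ltW.
have -> : c1 ^+ 2 = 1 - s1 ^+ 2 by lra.
have -> : c2 ^+ 2 = 1 - s2 ^+ 2 by lra.
have -> : s2 * (a - b.2 * s1 + m11 * (1 - s1 ^+ 2) + m22 * s1 ^+ 2) +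
  s1 * (a + b.2 * s2 + m11 * (1 - s2 ^+ 2) + m22 * s2 ^+ 2) =
  (s1 + s2) * (a + m11 + (m22 - m11) * (s1 * s2)) by ring.
have -> : s1 * s2 = 2^-1 by lra.
by rewrite pmulr_rge0; lra.
Qed.

Section slab_body.
Variables (R : realType) (U : set (R * R)) (s : R).

Lemma unit_disc_slab : (forall u, U u -> dot u u = 1) -> 1 <= s ->
  @unit_disc R `<=` slab U s.
Proof.
move=> Uu s1 z /unit_discE z1 u /Uu u1.
have : `|dot z u| <= 1.
  rewrite -(@expr_le1 _ 2)// ?normr_ge0// real_normK ?num_real//.
  by apply: le_trans (cauchy_schwarz _ _) _; rewrite u1 mulr1.
by rewrite ler_norml => /andP[h1 h2]; apply/andP; split; lra.
Qed.

(** Boundedness comes from the norm estimate [john_norm]. *)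
Lemma slab_convex_body : (forall u, U u -> dot u u = 1) -> john_set U ->
  1 <= s -> s <= 2 -> convex_body (slab U s).
Proof.
move=> Uu UJ s1 s2; split.
- have cS : compact (`[(-2 : R), 2]%classic `*` `[(-2 : R), 2]%classic).
    by apply: compact_setX; exact: segment_compact.
  apply: (subclosed_compact _ cS); last first.
    move=> z /(john_norm UJ); rewrite /dot => h; rewrite /= !in_itv /=.
    by split; apply/andP; split; nra.
  rewrite (_ : slab U s = \bigcap_(u in U)
     ((fun z : R * R => u.1 * z.1 + u.2 * z.2 + 0) @^-1` `[- s, 1]%classic)).
    apply: closed_bigI => u _; apply: closed_comp; last exact: itv_closed.
    by move=> z _; exact: continuous_affine.
  apply/seteqP; split => z sz u /sz /=; rewrite in_itv /= /dot;
   by rewrite addr0 [u.1 * _]mulrC [u.2 * _]mulrC.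
- move=> x y l /set_mem sx /set_mem sy; apply/mem_set => u uU.
  have /andP[x1 x2] := sx u uU; have /andP[y1 y2] := sy u uU.
  have l0 : 0 <= l%:num by [].
  have l1 : l%:num <= 1 by [].
  set z := (X in dot X u); have -> : dot z u = l%:num * dot x u + (1 - l%:num) * dot y u.
    by rewrite /z /dot /= /unstable.onem -![_ *: _]/(_ * _); ring.
  by apply/andP; split; nra.
- exists 0; apply: (@filterS _ _ _ [set z : R * R | dot z z < 1]).
    move=> z /ltW z1; apply: unit_disc_slab => //; exact/unit_discE.
  have cz : 0 * z.1 + 0 * z.2 + 1 * z.1 ^+ 2 + 0 * (z.1 * z.2) + 1 * z.2 ^+ 2 + 0
     @[z --> (0 : R * R)] --> 0 * (0 : R * R).1 + 0 * (0 : R * R).2 + 1 * (0 : R * R).1 ^+ 2 +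
       0 * ((0 : R * R).1 * (0 : R * R).2) + 1 * (0 : R * R).2 ^+ 2 + 0.
    exact: continuous_quadratic.
  have h01 : 0 * (0 : R * R).1 + 0 * (0 : R * R).2 + 1 * (0 : R * R).1 ^+ 2 +
       0 * ((0 : R * R).1 * (0 : R * R).2) + 1 * (0 : R * R).2 ^+ 2 + 0 < 1 by rewrite /=; lra.
  by apply: filterS (cvgr_lt _ cz _ h01) => z /=; rewrite /dot; lra.
Qed.

(** A point attaining the lower bound [-s] of the slab excludes any smaller
    factor. *)
Lemma slab_asymmetry x u0 : 1 <= s -> john_ellipse (slab U s) = @unit_disc R ->
  slab U s x -> U u0 -> dot x u0 = - s -> john_asymmetry (slab U s) = s.
Proof.
move=> s1 jK sx uU xu; rewrite john_asymmetryE//.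
have refl : scaled_reflection (slab U s) s.
  move=> z sz; exists (- z.1 / s, - z.2 / s); last first.
    by apply: injective_projections; rewrite /=; field; rewrite gt_eqF//; lra.
  move=> u uU'; have /andP[h1 h2] := sz u uU'.
  have -> : dot (- z.1 / s, - z.2 / s) u = - dot z u / s by rewrite /dot /=; ring.
  have s0 : 0 < s by lra.
  by rewrite ler_pdivlMr// ler_pdivrMr//; apply/andP; split; nra.
have lb rho : 0 <= rho -> scaled_reflection (slab U s) rho -> s <= rho.
  move=> r0 /(_ x sx) [k sk xE]; have /andP[_ k1] := sk u0 uU.
  have : - s = - (rho * dot k u0) by rewrite -xu xE /dot /=; ring.
  have : rho * dot k u0 <= rho * 1 by apply: ler_wpM2l.
  lra.
apply/eqP; rewrite eq_le; apply/andP; split.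
  apply: ge_inf; last by split => //; lra.
  by exists 0 => rho [].
apply: lb_le_inf; first by exists s; split => //; lra.
by move=> rho [r0 /lb]; exact.
Qed.

End slab_body.

(** With endpoints [(D/2, h)] and [(-D/2, h)], the lower contact points
    [(c1, -s1)], [(-c1, -s1)] are chosen so that the endpoints have products [1]
    and [-s] with them, and [s2] so that the trapezoid balances.  That the upper
    contact points then have product [1] with an endpoint is the quadratic
    equation satisfied by [D^2]. *)
Lemma extremal_parameters (R : realType) (s : R) : 1 <= s -> s <= 2 ->
  let D := john_diam_bound s in
  exists c1 s1 c2 s2 h, [/\ 0 < s1, 2 * s1 * s2 = 1, c1 ^+ 2 + s1 ^+ 2 = 1,
    c2 ^+ 2 + s2 ^+ 2 = 1 & [/\ D / 2 * c1 = (1 + s) / 2, h * s1 = (s - 1) / 2,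
     0 <= c2, 0 <= h * s2 & D / 2 * c2 + h * s2 = 1]].
Proof.
move=> s1' s2' D; have D8 := john_diam_bound_sqr_ge8 s2'; have D0 := john_diam_bound_ge0 s.
have DE := john_diam_bound_sqr s; have WE := inner_root_sqr s.
set W := Num.sqrt _ in DE WE; have W0 : 0 <= W by exact: sqrtr_ge0.
rewrite -/D in D8 D0 DE.
have {}D0 : 0 < D by rewrite lt_neqAle D0 andbT eq_sym; apply/eqP => DD; move: D8; rewrite DD; lra.
pose m := (1 + s) ^+ 2.
have Zm : 4 * m <= 3 * D ^+ 2.
  rewrite DE /m; suff : s ^+ 2 + 8 * s - 11 <= 3 * W by lra.
  rewrite leNgt; apply/negP => h.
  have : (3 * W) ^+ 2 < (s ^+ 2 + 8 * s - 11) ^+ 2.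
    by rewrite ltr_pXn2r// nnegrE; lra.
  have := sqr_ge0 (s ^+ 2 - s - 2).
  have -> : (3 * W) ^+ 2 = 9 * W ^+ 2 by ring.
  by rewrite WE; lra.
have Zpoly : (D ^+ 2) ^+ 2 = 2 * (s ^+ 2 + 5) * D ^+ 2 - 8 * m.
  have : (D ^+ 2 - (s ^+ 2 + 5)) ^+ 2 = W ^+ 2 by rewrite DE; ring.
  by rewrite WE /m; lra.
have Z0 : 0 < D ^+ 2 by lra.
pose q := 1 - m / D ^+ 2.
have q4 : 4^-1 <= q by rewrite /q; have : m / D ^+ 2 <= 3 / 4 by [rewrite ler_pdivrMr//; lra]; lra.
have q0 : 0 < q by lra.
pose s1 := Num.sqrt q.
have s10 : 0 < s1 by rewrite sqrtr_gt0.
have s1E : s1 ^+ 2 = q by rewrite sqr_sqrtr// ltW.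
pose s2 := (2 * s1)^-1.
have ss : 2 * s1 * s2 = 1 by rewrite /s2 divff// gt_eqF//; lra.
have s2E : s2 ^+ 2 = (4 * q)^-1.
  by rewrite /s2 exprVn; congr (_^-1); rewrite exprMn s1E; ring.
have s21 : s2 ^+ 2 <= 1 by rewrite s2E invf_le1; lra.
pose c2 := Num.sqrt (1 - s2 ^+ 2).
have c2E : c2 ^+ 2 = 1 - s2 ^+ 2 by rewrite sqr_sqrtr//; lra.
pose h := (s - 1) / (2 * s1).
have hs2 : h * s2 = (s - 1) / (4 * q).
  by rewrite /h /s2 -s1E; field; rewrite gt_eqF.
have hs20 : 0 <= h * s2 by rewrite hs2 divr_ge0//; lra.
have hs21 : h * s2 <= 1 by rewrite hs2 ler_pdivrMr; lra.
exists ((1 + s) / D), s1, c2, s2, h; split => //.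
- by rewrite s1E /q /m; field; rewrite gt_eqF.
- by rewrite c2E; ring.
split => //.
- by field; rewrite gt_eqF.
- by rewrite /h; field; rewrite gt_eqF.
- exact: sqrtr_ge0.
suff : D / 2 * c2 = 1 - h * s2 by lra.
apply/eqP; rewrite -(@eqrXn2 _ 2)//; [|by rewrite mulr_ge0 ?sqrtr_ge0// divr_ge0// ltW|lra].
rewrite -subr_eq0 exprMn c2E s2E hs2.
have qZ : q * D ^+ 2 = D ^+ 2 - m by rewrite /q; field; rewrite gt_eqF.
have X0 : 16 * (q * D ^+ 2) ^+ 2 != 0 by rewrite gt_eqF// mulr_gt0// exprn_gt0// mulr_gt0.
apply/eqP/(mulIf X0); rewrite mul0r.
have -> : ((D / 2) ^+ 2 * (1 - (4 * q)^-1) - (1 - (s - 1) / (4 * q)) ^+ 2) * (16 * (q * D ^+ 2) ^+ 2)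
  = D ^+ 2 * (q * D ^+ 2) * (4 * (q * D ^+ 2) - D ^+ 2) - (4 * (q * D ^+ 2) - (s - 1) * D ^+ 2) ^+ 2.
  by field; rewrite gt_eqF.
rewrite qZ.
transitivity ((3 * D ^+ 2 - 2 * m) * ((D ^+ 2) ^+ 2 - (2 * (s ^+ 2 + 5) * D ^+ 2 - 8 * m))).
  by rewrite /m; ring.
by rewrite Zpoly subrr mulr0.
Qed.

Lemma extremal_body (R : realType) (s : R) : 1 <= s <= 2 ->
  exists K : set (R * R),
    [/\ convex_body K, john_ellipse K = @unit_disc R,
        john_asymmetry K = s & diameter K = john_diam_bound s].
Proof.
move=> /andP[s1 s2].
have [c1 [t1 [c2 [t2 [h [t10 tt h1 h2 [X1 H1 c20 ht ht2]]]]]]] := extremal_parameters s1 s2.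
set D := john_diam_bound s in X1 ht2 *.
pose U := trapezoid c1 t1 c2 t2; pose K := slab U s.
have Uu u : U u -> dot u u = 1.
  by rewrite /dot; case => -> /=; lra.
have qU : john_set U by exact: trapezoid_john_set.
have bK : convex_body K by exact: slab_convex_body Uu qU s1 s2.
have jK : john_ellipse K = @unit_disc R.
  apply: (john_sufficiency Uu qU); first exact: unit_disc_slab.
  by move=> z u /[apply] /andP[].
have D0 : 0 <= D by exact: john_diam_bound_ge0.
have Dc2 : 0 <= D / 2 * c2 by rewrite mulr_ge0// divr_ge0.
have Kx : K (D / 2, h).
  by move=> u [] ->; rewrite /dot /=; apply/andP; split; lra.
have Ky : K (- (D / 2), h).
  by move=> u [] ->; rewrite /dot /=; apply/andP; split; lra.
have sK : john_asymmetry K = s.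
  apply: (@slab_asymmetry R U s (D / 2, h) (- c1, - t1)) => //; first by constructor 2.
  by rewrite /dot /=; lra.
exists K; split => //.
have := diameter_le bK jK; rewrite sK -/D => dle.
apply/eqP; rewrite eq_le dle /=.
apply: ub_le_sup.
  exists D => _ [x [y [Kx' Ky' ->]]].
  by have := pair_distance_le bK jK Kx' Ky'; rewrite sK.
exists (D / 2, h), (- (D / 2), h); split => //.
rewrite enormE (_ : dot _ _ = D ^+ 2); last by rewrite /dot /=; field.
by rewrite sqrtr_sqr ger0_norm.
Qed.

(** * The diameter theorem *)

Unset Implicit Arguments.

Theorem theorem1p5 (R : realType) :
  (forall K : set (R * R),
     convex_body K -> john_ellipse K = @unit_disc R ->
     diameter K <= john_diam_bound (john_asymmetry K) /\
     (forall x y : R * R, K x -> K y ->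
        (enorm (x - y) = john_diam_bound (john_asymmetry K) <->
         (enorm x = Num.sqrt (2^-1 * john_diam_bound (john_asymmetry K) ^+ 2 - 2) /\
          enorm y = Num.sqrt (2^-1 * john_diam_bound (john_asymmetry K) ^+ 2 - 2)) /\
         enorm (2^-1 *: (x + y)) =
           Num.sqrt (4^-1 * john_diam_bound (john_asymmetry K) ^+ 2 - 2)))) /\
  (forall s : R, 1 <= s <= 2 ->
     exists K : set (R * R),
       [/\ convex_body K, john_ellipse K = @unit_disc R,
           john_asymmetry K = s & diameter K = john_diam_bound s]).
Proof.
split; last exact: extremal_body.
move=> K bK jK; split; first exact: diameter_le bK jK.
by move=> x y Kx Ky; exact (diameter_eq_iff bK jK Kx Ky).
Qed.
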